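(* Consider the PARID-model with initial degrees $\{W_i\}_{i\ge 1}$ and parameter $\delta$. If $\mathbb{E}[W_1^{1+\varepsilon}]<\infty$ for some $\varepsilon>0$, then there exists a constant $\gamma\in(0,\tfrac12)$ such that $$\lim_{t\to\infty}\mathbb{P}\Big(\max_{k\ge 1}|p_k(t)-p_k|\ge t^{-\gamma}\Big)=0.$$ Moreover, when $r_m=1$ for some integer $m\ge 1$, then $t^{-\gamma}$ can be replaced by $C\sqrt{\tfrac{\log t}{t}}$ for some sufficiently large constant $C$, i.e. there is a constant $C$ such that $$\lim_{t\to\infty}\mathbb{P}\Big(\max_{k\ge 1}|p_k(t)-p_k|\ge C\sqrt{\tfrac{\log t}{t}}\Big)=0.$$
   Context: PARID-model (preferential attachment with random initial degrees). Let $\{W_i\}_{i\ge1}$ be an i.i.d. sequence of positive-integer-valued random variables, with support $S_W$, and write $r_k=\mathbb{P}(W_1=k)$ for $k\ge1$. Let $\delta\in\mathbb{R}$ be fixed with $\delta+\min\{x:x\in S_W\}>0$. Put $L_t=\sum_{i=1}^tW_i$. The random (multi)graph process $\{G(t)\}_{t\ge1}$ is defined as follows. $G(1)$ consists of two vertices $v_0,v_1$ with $W_1$ edges joining them. For $t\ge2$, $G(t)$ is obtained from $G(t-1)$ by adding a vertex $v_t$ and $W_t$ edges from $v_t$ to $\{v_0,\dots,v_{t-1}\}$. Conditionally on $G(t-1)$ and the initial degrees, the endpoints of these $W_t$ edges are chosen independently (with replacement), each equal to $v_i$ with probability $$\frac{d_i(t-1)+\delta}{\sum_{j=0}^{t-1}(d_j(t-1)+\delta)}=\frac{d_i(t-1)+\delta}{2L_{t-1}+t\delta},\qquad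 0\le i\le t-1,$$ where $d_i(s)$ denotes the degree of $v_i$ in $G(s)$ (edges counted with multiplicity). $N_k(t)$ is the number of vertices of degree $k$ in $G(t)$, and $p_k(t)=N_k(t)/(t+1)$. Limiting sequence: when $\mu=\mathbb{E}[W_1]<\infty$, let $\theta=2+\delta/\mu$ and $$p_k=\frac{\theta}{k+\delta+\theta}\sum_{i=0}^{k-1}r_{k-i}\prod_{j=1}^{i}\frac{k-j+\delta}{k-j+\delta+\theta},\qquad k\ge1,$$ where the empty product ($i=0$) equals one, and the summands with $r_{k-i}=0$ are read as $0$ (so $p_k=0$ for $k<\min S_W$). *)

(* Defs.v *)
From HB Require Import structures.
From mathcomp Require Import all_boot all_order all_algebra.
From mathcomp Require Import all_classical all_reals all_analysis.

Set Implicit Arguments.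
Unset Strict Implicit.
Unset Printing Implicit Defensive.

Import Order.TTheory GRing.Theory Num.Theory.
Import numFieldNormedType.Exports.

Local Open Scope classical_set_scope.
Local Open Scope ring_scope.

Section Probability.
Context d (T : measurableType d) (R : realType) (P : probability T R).

Definition cond_prob (A B : set T) : R := fine (P (A `&` B)) / fine (P B).

(* The sequence is indexed by i >= 1; W 0 plays no role. *)
Definition iid (W : nat -> {RV P >-> nat}) : Prop :=
  (forall i, (0 < i)%N -> distribution P (W i) =1 distribution P (W 1%N)) /\
  (forall (J : seq nat) (A : nat -> set nat), uniq J -> (forall i, i \in J -> (0 < i)%N) ->
     P [set w | forall i, i \in J -> A i (W i w)] =
     (\prod_(i <- J) P (W i @^-1` A i))%E).

Definition prob_mass (Y : {RV P >-> nat}) (k : nat) : R := fine (P (Y @^-1` [set k])).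

Definition support_set (Y : {RV P >-> nat}) : set nat := [set k | 0 < prob_mass Y k].

End Probability.

Definition is_min (S : set nat) (m : nat) : Prop := S m /\ forall k, S k -> (m <= k)%N.

(* A loopless multigraph on the vertices v_0, ..., v_n is represented by its
   symmetric matrix of edge multiplicities. *)
Definition degree n (g : 'M[nat]_n.+1) (i : 'I_n.+1) : nat := (\sum_j g i j)%N.

Definition attach_prob (R : realType) (delta : R) n (g : 'M[nat]_n.+1)
    (i : 'I_n.+1) : R :=
  ((degree g i)%:R + delta) / \sum_(j < n.+1) ((degree g j)%:R + delta).

Section Graph.
Context {T : Type} (W : nat -> T -> nat) (X : nat -> nat -> T -> nat).

(* X s e is the index of the endpoint, among v_0, ..., v_(s-1), of the e-th of
   the edges (0 <= e < W s) sent out by v_s.  For s = 1 this endpoint is v_0, so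
   that the graph at time 1 consists of W 1 edges between v_0 and v_1. *)
Definition pa_graph (n : nat) (w : T) : 'M[nat]_n.+1 :=
  (\matrix_(i < n.+1, j < n.+1)
     \sum_(1 <= s < n.+1) \sum_(e < W s w)
       (((s == i) && (X s e w == j)) || ((s == j) && (X s e w == i))))%N.

Definition nb_degree (k n : nat) (w : T) : nat :=
  #|[pred i : 'I_n.+1 | degree (pa_graph n w) i == k]|.

Definition emp_degree (R : realType) (k n : nat) (w : T) : R :=
  (nb_degree k n w)%:R / n.+1%:R.

End Graph.

(* In parid_step, (W 1, ..., W N) ranges over all lengths N > n; the events
   W 1 = c 1, ..., W N = c N generate the sigma-algebra of (W i)_(i >= 1), so
   the field describes the conditional law of the endpoints of the edges of
   v_(n+1) given the graph at time n and all the initial degrees. *)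
Record PARID d (T : measurableType d) (R : realType) (P : probability T R)
    (delta : R) (W : nat -> {RV P >-> nat}) (X : nat -> nat -> {RV P >-> nat}) :
    Prop := {
  parid_iid : iid W;
  parid_pos : forall i w, (0 < i)%N -> (0 < W i w)%N;
  parid_delta : exists m, is_min (support_set (W 1%N)) m /\ 0 < delta + m%:R;
  parid_endpoint : forall s e w, (0 < s)%N -> (e < W s w)%N -> (X s e w < s)%N;
  parid_step : forall (n N : nat) (c : nat -> nat) (g : 'M[nat]_n.+1)
      (x : 'I_(c n.+1) -> 'I_n.+1),
    (0 < n)%N -> (n < N)%N ->
    let past := [set w | pa_graph W X n w = g /\
                         forall i, (1 <= i <= N)%N -> W i w = c i] in
    (0 < P past)%E ->
    cond_prob P [set w | forall e : 'I_(c n.+1), X n.+1 e w = x e] past =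
    \prod_(e < c n.+1) attach_prob delta g (x e)
}.

Section Limit.
Context d (T : measurableType d) (R : realType) (P : probability T R)
  (delta : R) (W : nat -> {RV P >-> nat}).

Definition mean_degree : R := fine 'E_P[fun w => (W 1%N w)%:R].

Definition theta : R := 2 + delta / mean_degree.

(* A denominator can vanish only at an argument k or k - j below the minimum of
   the support of W 1.  Division being total, every term where this happens has
   a factor prob_mass (W 1) (k - i) = 0 and so is 0. *)
Definition limit_degree (k : nat) : R :=
  theta / (k%:R + delta + theta) *
  \sum_(0 <= i < k) prob_mass (W 1%N) (k - i) *
     \prod_(1 <= j < i.+1)
        ((k%:R - j%:R + delta) / (k%:R - j%:R + delta + theta)).

(* The deviations tend to 0 as k grows, so this supremum is a maximum. *)
Definition max_dev (X : nat -> nat -> {RV P >-> nat}) (t : nat) (w : T) : \bar R :=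
  ereal_sup [set (`|emp_degree W X R k t w - limit_degree k|)%:E
            | k in [set k | (1 <= k)%N]].

End Limit.

(* Main.v *)
Require Import Defs.
From mathcomp Require Import all_boot all_order all_algebra.
From mathcomp Require Import all_classical all_reals all_analysis.
From mathcomp Require Import measurable_realfun ring lra.
Import Order.TTheory GRing.Theory Num.Theory.
Import numFieldNormedType.Exports.
Local Open Scope classical_set_scope.
Local Open Scope ring_scope.

Set Implicit Arguments.
Unset Strict Implicit.
Unset Printing Implicit Defensive.


(** Write a_k = k + delta, S for the total weight of the graph at time n, N_k
    for the number of its vertices of degree k, and v_k = N_k - (n+1) p_k.  The
    theorem follows from a bound on the second moment D_n = E (sum_k v_k^2)
    and Markov's inequality, because max_k |p_k(t) - p_k| is at most
    (sum_k v_k^2)^(1/2) / (t+1): the sum over k replaces a union bound over the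
    degrees, so that second moments suffice.

    The bound on D_n is a Lyapunov argument.  Given the graph at time n and
    W_(n+1) = c, a vertex of degree j gains a Bin(c, q_j) number of edges, with
    q_j = a_j / S, so that the conditional mean of N(n+1) is Q^T N(n) plus a unit
    mass at c, for the transition matrix Q of j -> j + Bin(c, q_j).  The rows
    of Q sum to 1 and, because q_j increases with j, its columns sum to at most
    1 ([transition_col_sum]); hence <v, Q^T v> <= |v|^2 ([schur_test]), and the
    part of the drift that is linear in v never increases D_n.  The
    remaining part of the drift is deterministic.  The limit law satisfies
    theta (p_k - r_k) = a_(k-1) p_(k-1) - a_k p_k ([limit_seq_rec]), which
    says that Q^T p - p equals (c / S) theta (p - r) up to an error; as
    p_k = O(k^(-2)) ([limit_seq_decay]), this error is O(c^2 / n^2) uniformly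
    in k ([stationarity_error]), and pairing it with the l1 norm of v, at most
    2 (n+1), and with the factor n+1 costs O(c^2).  The squared increments also
    cost O(c^2).  Since |v| is at most 2 (n+1) in any case, every c^2 may be
    replaced by c min(c, n+1), which only needs a moment of order 1 + eps
    ([one_step]).

    As W_(n+1) is independent of the graph at time n ([past_independence]), c
    can then be averaged.  With mu = E W and theta mu = 2 mu + delta the
    first order terms combine into 2 <v, p - r> ((n+1) theta mu / S - 1), which
    is at most a constant times |mu (n+1) - L_n| ([deviation_step]).  The
    expectation of this is controlled by the same one-step method, applied to
    (lam^2 + (L_n - n mu)^2)^(1/2) ([edge_count_concentration]).  Altogether
    ([deviation_bound])

      D_t <= 16 + C t (mu + lam + t E min((W - mu)^2 / lam, 2 |W - mu|)
                       + E (W min(W, t))).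

    With a moment of order 1 + e, e <= 1, and lam = t^(1/2) this is
    O(t^(2 - e/2)), so that gamma = e/8 works; with W constant and lam = 1 it
    is O(t), whence the rate (log t / t)^(1/2), even with C = 1. *)

(** * Binomial jumps *)

Section Binomial.
Context {R : realFieldType}.
Implicit Types (q x : R) (c l : nat).

(** The probability generating function of one trial.  Taking the binomial
    weights as coefficients of its powers turns [load_distribution] into the
    expansion of a product of sums. *)
Definition binpoly q : {poly R} := (1 - q)%:P + q%:P * 'X.

Definition binpmf q c l : R := (binpoly q ^+ c)`_l.

(** The probability that Bin(c, q) is at least l, by conditioning on one trial:
    in this form monotonicity in q is an induction on c. *)
Fixpoint bintail q c l : R :=
  if c is c'.+1 then (1 - q) * bintail q c' l + q * bintail q c' l.-1
  else (l == 0%N)%:R.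

Lemma binpmf0 q l : binpmf q 0 l = (l == 0%N)%:R.
Proof. by rewrite /binpmf expr0 coef1. Qed.

Lemma binpmfS0 q c : binpmf q c.+1 0 = (1 - q) * binpmf q c 0.
Proof.
by rewrite /binpmf exprS /binpoly mulrDl coefD -mulrA !coefCM coefXM mulr0 addr0.
Qed.

Lemma binpmfSS q c l :
  binpmf q c.+1 l.+1 = (1 - q) * binpmf q c l.+1 + q * binpmf q c l.
Proof. by rewrite /binpmf exprS /binpoly mulrDl coefD -mulrA !coefCM coefXM. Qed.

Lemma bintail0 q c : bintail q c 0 = 1.
Proof. by elim: c => [|c /= ->] //=; rewrite !mulr1 subrK. Qed.

Lemma binpmfE q c l : binpmf q c l = bintail q c l - bintail q c l.+1.
Proof.
elim: c l => [|c IH] [|l]; rewrite ?binpmf0 ?binpmfS0 ?binpmfSS ?IH /= ?subr0 //.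
  by rewrite !bintail0; ring.
by ring.
Qed.

Lemma binpmf_ge0 q c l : 0 <= q <= 1 -> 0 <= binpmf q c l.
Proof.
move=> /andP[q0 q1]; elim: c l => [|c IH] [|l].
- by rewrite binpmf0.
- by rewrite binpmf0.
- by rewrite binpmfS0 mulr_ge0 // subr_ge0.
- by rewrite binpmfSS addr_ge0 // mulr_ge0 // subr_ge0.
Qed.

Lemma bintailS_le q c l : 0 <= q <= 1 -> bintail q c l.+1 <= bintail q c l.
Proof. by move=> q01; rewrite -subr_ge0 -binpmfE binpmf_ge0. Qed.

Lemma bintail_le1 q c l : 0 <= q <= 1 -> bintail q c l <= 1.
Proof.
move=> q01; elim: l => [|l IH]; first by rewrite bintail0.
exact: le_trans (bintailS_le _ _ q01) IH.
Qed.

Lemma bintail_ge0 q c l : 0 <= q <= 1 -> 0 <= bintail q c l.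
Proof.
move=> /andP[q0 q1]; elim: c l => [|c IH] l /=; first by case: l.
by rewrite addr_ge0 // mulr_ge0 // subr_ge0.
Qed.

Lemma bintail_mono q q' c l : 0 <= q -> q <= q' -> q' <= 1 ->
  bintail q c l <= bintail q' c l.
Proof.
move=> q0 qq' q1; elim: c l => [|c IH] l //=.
have q01 : 0 <= q <= 1 by rewrite q0 (le_trans qq').
have q01' : 0 <= q' <= 1 by rewrite (le_trans q0).
case: l => [|l] /=; first by rewrite !bintail0; lra.
have := IH l.+1; have := IH l; have := bintailS_le c l q01'.
move: (bintail q c l) (bintail q c l.+1) (bintail q' c l) (bintail q' c l.+1).
move=> a b a' b' h1 h2 h3; nra.
Qed.

Lemma sum_binpmf q c n : \sum_(l < n) binpmf q c l = 1 - bintail q c n.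
Proof.
elim: n => [|n IH]; first by rewrite big_ord0 bintail0 subrr.
by rewrite big_ord_recr /= IH binpmfE; ring.
Qed.

Lemma binpmf_le1 q c l : 0 <= q <= 1 -> binpmf q c l <= 1.
Proof.
move=> q01; rewrite binpmfE; have := bintail_le1 c l q01.
have := bintail_ge0 c l.+1 q01; lra.
Qed.

(** Both sides count a distinguished success.  Used twice, the identity gives
    P(B = l) <= c^2 q^2 / (l (l-1)), which is summable in l with no loss in c. *)
Lemma binpmf_diag q c l :
  l.+1%:R * binpmf q c.+1 l.+1 = c.+1%:R * q * binpmf q c l.
Proof.
elim: c l => [|c IH] l.
  rewrite binpmfSS !binpmf0; case: l => [|l] /=; ring.
rewrite binpmfSS; case: l => [|l].
  have := IH 0%N; rewrite binpmfS0 mul1r => h; rewrite mul1r h.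
  by rewrite -[c.+2%:R]natr1; ring.
have h1 := IH l; have h2 := IH l.+1; have h3 := binpmfSS q c l.
move: h1 h2 h3; rewrite -[c.+2%:R]natr1 -[c.+1%:R]natr1 -[l.+2%:R]natr1.
move: (binpmf q c.+1 l.+1) (binpmf q c.+1 l.+2) (binpmf q c l) (binpmf q c l.+1).
move: (l.+1%:R) (c%:R + 1) => L N b1 b2 a0 a1 h1 h2 h3.
apply/eqP; rewrite -subr_eq0; apply/eqP.
transitivity ((1 - q) * ((L + 1) * b2 - N * q * a1) + q * (L * b1 - N * q * a0)
              - N * q * (b1 - ((1 - q) * a1 + q * a0))); first by ring.
by rewrite h1 h2 h3 !subrr !mulr0 subr0 addr0.
Qed.

(** Only the first order term in c q has to be exact; it is the one that the
    stationarity equation of the limit law cancels. *)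
Lemma binpmf_zero_bounds q c : 0 <= q <= 1 ->
  1 - c%:R * q <= binpmf q c 0 <= 1 - c%:R * q + c%:R ^+ 2 * q ^+ 2.
Proof.
move=> /andP[q0 q1]; elim: c => [|c /andP[IH1 IH2]].
  by rewrite binpmf0 /=; apply/andP; split; lra.
rewrite binpmfS0 -natr1; move: (binpmf q c 0) IH1 IH2 => b.
have : 0 <= c%:R :> R by [].
move: (c%:R : R) => C C0 h1 h2.
apply/andP; split; first by nra.
have : (1 - q) * b <= (1 - q) * (1 - C * q + C ^+ 2 * q ^+ 2) by rewrite ler_wpM2l ?subr_ge0.
have : 0 <= C * q ^+ 2 by rewrite mulr_ge0 // sqr_ge0.
have : 0 <= C ^+ 2 * q ^+ 3 by rewrite mulr_ge0 ?sqr_ge0 // exprn_ge0.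
have := sqr_ge0 q.
nra.
Qed.

Lemma binpmf_one_bounds q c : 0 <= q <= 1 ->
  c%:R * q - c%:R ^+ 2 * q ^+ 2 <= binpmf q c 1 <= c%:R * q.
Proof.
case: c => [|c] q01; first by rewrite binpmf0 /=; apply/andP; split; lra.
have := binpmf_diag q c 0; rewrite mul1r => ->.
have /andP[h1 _] := binpmf_zero_bounds c q01.
have h2 := binpmf_le1 c 0 q01; move/andP: q01 => [q0 q1].
have hc : 0 <= c.+1%:R * q by rewrite mulr_ge0.
apply/andP; split; last by rewrite ler_piMr.
apply: (@le_trans _ _ (c.+1%:R * q * (1 - c%:R * q))); last by rewrite ler_wpM2l.
rewrite -natr1; have : 0 <= c%:R :> R by [].
by move: (c%:R : R) hc => C hc C0; have := sqr_ge0 q; nra.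
Qed.

(** The dependence on the jump length of the bound in
    [binpmf_linearization]. *)
Definition jump_weight l : R := if (l < 2)%N then 1 else ((l * l.-1)%:R)^-1.

Lemma jump_weight_ge0 l : 0 <= jump_weight l.
Proof. by rewrite /jump_weight; case: ifP => // _; rewrite invr_ge0. Qed.

(** For l >= 2 the weights telescope, as 1/(l(l-1)) = 1/(l-1) - 1/l. *)
Lemma sum_jump_weight n : \sum_(l < n) jump_weight l <= 3.
Proof.
have key k : \sum_(l < k.+2) jump_weight l <= 3 - k.+1%:R^-1.
  elim: k => [|k IH].
    by rewrite !big_ord_recr big_ord0 /= /jump_weight /= invr1; lra.
  rewrite big_ord_recr /=; apply: le_trans (lerD IH (lexx _)) _.
  rewrite /jump_weight /= natrM invfM -addrA lerD2l.
  have k1 : 0 < k.+1%:R :> R by [].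
  have k2 : 0 < k.+2%:R :> R by [].
  rewrite -subr_ge0 (_ : _ - _ = 0) //.
  have -> : k.+2%:R = k.+1%:R + 1 :> R by rewrite natr1.
  have : k.+1%:R + 1 != 0 :> R by rewrite natr1 gt_eqF.
  have : k.+1%:R != 0 :> R by rewrite gt_eqF.
  move: (k.+1%:R : R) => K h1 h2; field.
  by rewrite h1 h2.
case: n => [|[|n]].
- by rewrite big_ord0.
- by rewrite big_ord_recr big_ord0 /= /jump_weight /=; lra.
- by apply: le_trans (key n) _; rewrite lerBlDr lerDl invr_ge0.
Qed.

(** The limit law charges degrees j with j + delta > S, and below the minimal
    degree j + delta may be negative.  No vertex has such a degree, and clamping
    keeps the attachment probability in [0, 1] and nondecreasing in j. *)
Definition clamp01 x : R := Num.max 0 (Num.min 1 x).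

Lemma clamp01_itv x : 0 <= clamp01 x <= 1.
Proof.
by rewrite /clamp01 le_max lexx /= ge_max ler01 /= ge_min lexx.
Qed.

Lemma clamp01_mono x y : x <= y -> clamp01 x <= clamp01 y.
Proof.
move=> xy; rewrite /clamp01 ge_max !le_max lexx /=; apply/orP; right.
by rewrite le_min !ge_min lexx xy /= orbT.
Qed.

Lemma clamp01_id x : 0 <= x <= 1 -> clamp01 x = x.
Proof. by move=> /andP[x0 x1]; rewrite /clamp01 (min_idPr x1) (max_idPr x0). Qed.

Lemma clamp01_ge1 x : 1 <= x -> clamp01 x = 1.
Proof. by move=> x1; rewrite /clamp01 (min_idPl x1) (max_idPr ler01). Qed.

(** For x > 1 every trial succeeds: then for l < 2 the left-hand side is at most
    c x <= (c x)^2, and for l >= 2 it is 1 if l = c, with c^2 >= l (l-1), and 0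
    otherwise. *)
Lemma binpmf_linearization x c l : 0 <= x -> (0 < c)%N ->
  `| binpmf (clamp01 x) c l - (l == 0%N)%:R
     - c%:R * x * ((l == 1%N)%:R - (l == 0%N)%:R) |
  <= c%:R ^+ 2 * x ^+ 2 * jump_weight l.
Proof.
move=> x0 c0.
have c1 : 1 <= c%:R :> R by rewrite ler1n.
have [x1|x1] := leP x 1.
  have x01 : 0 <= x <= 1 by rewrite x0.
  rewrite clamp01_id // /jump_weight.
  case: l => [|[|l]] /=.
  - by have /andP[h1 h2] := binpmf_zero_bounds c x01; rewrite ler_norml; apply/andP; split; lra.
  - by have /andP[h1 h2] := binpmf_one_bounds c x01; rewrite ler_norml; apply/andP; split; lra.
  - rewrite !subr0 mulr0 subr0 ger0_norm ?binpmf_ge0 //.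
    rewrite ler_pdivlMr ?ltr0n ?muln_gt0 //.
    case: c c0 c1 => [//|[|c]] _ _.
      by rewrite binpmfSS !binpmf0 /= !mulr0 addr0 mul0r mulr_ge0 ?sqr_ge0.
    have h1 := binpmf_diag x c.+1 l.+1; have h2 := binpmf_diag x c l.
    have -> : binpmf x c.+2 l.+2 * (l.+2 * l.+1)%:R
            = c.+2%:R * c.+1%:R * x ^+ 2 * binpmf x c l.
      rewrite natrM.
      transitivity (l.+1%:R * (l.+2%:R * binpmf x c.+2 l.+2)); first by ring.
      rewrite h1.
      transitivity (c.+2%:R * x * (l.+1%:R * binpmf x c.+1 l.+1)); first by ring.
      by rewrite h2; ring.
    have h3 := binpmf_le1 c l x01.
    apply: (@le_trans _ _ (c.+2%:R * c.+1%:R * x ^+ 2)).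
      by rewrite ler_piMr // !mulr_ge0 ?sqr_ge0.
    by rewrite ler_wpM2r ?sqr_ge0 // expr2 ler_wpM2l // ler_nat.
rewrite clamp01_ge1; last exact: ltW.
have b01 := @binpmf_le1 1 c l; have b00 := @binpmf_ge0 1 c l.
have {}b01 := b01 _; have one01 : 0 <= (1:R) <= 1 by rewrite ler01 lexx.
have {}b01 := b01 one01; have {}b00 := b00 one01.
have x2 : c%:R * x <= c%:R ^+ 2 * x ^+ 2.
  by rewrite -exprMn ler_eXnr //; nra.
have cx1 : 1 <= c%:R * x by nra.
rewrite /jump_weight; case: l b01 b00 => [|[|l]] /= b01 b00.
- have b0 : binpmf 1 c 0 = 0 by case: c {c1 x2 cx1 b01 b00} c0 => // c _; rewrite binpmfS0 subrr mul0r.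
  by rewrite b0 ler_norml; apply/andP; split; lra.
- by rewrite ler_norml; apply/andP; split; lra.
- rewrite !subr0 mulr0 subr0 ger0_norm //.
  have one : binpmf 1 c l.+2 = (c == l.+2)%:R.
    rewrite /binpmf /binpoly subrr add0r mul1r coefXn eq_sym //.
  rewrite one; case: eqP => [->|_]; last by rewrite /= !mulr_ge0 ?sqr_ge0 ?invr_ge0.
  rewrite ler_pdivlMr ?ltr0n ?muln_gt0 // mul1r.
  apply: (@le_trans _ _ (l.+2%:R ^+ 2)).
    by rewrite -natrX ler_nat -mulnn leq_mul.
  by rewrite ler_peMr ?sqr_ge0 // expr_ge1 // ltW.
Qed.

End Binomial.

(** * The limit law *)

(** [law_rec] is stationarity: the mass at k changes by the flux from k-1, the
    flux to k+1 and the newborn mass [r k].  [law_decay] controls the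
    second order terms of the one-step estimate. *)
Record limit_law {R : realFieldType} (delta theta Cp : R) (p r : nat -> R) : Prop := {
  law_ge0 : forall k, 0 <= p k;
  law_sum : forall K, \sum_(k < K) p k <= 1;
  law_init : forall k, 0 <= r k <= 1;
  law_rec : forall k, theta * (p k - r k) =
    (if k is k'.+1 then (k'%:R + delta) * p k' else 0) - (k%:R + delta) * p k;
  law_pos : forall k, p k != 0 -> 0 <= k%:R + delta;
  law_decay : forall k, p k * (k%:R + delta) ^+ 2 <= Cp
}.

Section LimitSequence.
Context {R : realFieldType}.
Variables (delta theta mu : R) (r : nat -> R) (m : nat).

Definition limit_seq (k : nat) : R :=
  theta / (k%:R + delta + theta) *
  \sum_(0 <= i < k) r (k - i)%N *
     \prod_(1 <= j < i.+1)
        ((k%:R - j%:R + delta) / (k%:R - j%:R + delta + theta)).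

Hypothesis m_gt0 : (0 < m)%N.
Hypothesis r_small : forall k, (k < m)%N -> r k = 0.
Hypothesis r_ge0 : forall k, 0 <= r k.
Hypothesis r_sum : forall K, \sum_(k < K) r k <= 1.
Hypothesis r_mean : forall K, \sum_(k < K) k%:R * r k <= mu.
Hypothesis delta_m : 0 < delta + m%:R.
Hypothesis theta_gt1 : 1 < theta.

Let p := limit_seq.

Lemma limit_seq_small k : (k < m)%N -> p k = 0.
Proof.
move=> km; rewrite /p /limit_seq big_nat big1 ?mulr0 // => i /andP[_ ik].
by rewrite r_small ?mul0r // (leq_ltn_trans (leq_subr _ _)).
Qed.

Lemma shifted_gt0 k : (m <= k)%N -> 0 < k%:R + delta.
Proof.
move=> mk; have : m%:R <= k%:R :> R by rewrite ler_nat.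
by move: delta_m; lra.
Qed.

(** Splitting off the term i = 0 and the factor j = 1 of each product leaves the
    series that defines the value at k. *)
Lemma limit_seq_step k : (m <= k)%N ->
  (k.+1%:R + delta + theta) * p k.+1 = (k%:R + delta) * p k + theta * r k.+1.
Proof.
move=> mk; have hk := shifted_gt0 mk.
have hk1 := shifted_gt0 (leqW mk); have t1 := theta_gt1.
have n1 : k.+1%:R + delta + theta != 0 by rewrite gt_eqF //; lra.
have n0 : k%:R + delta + theta != 0 by rewrite gt_eqF //; lra.
have clear_den (d s : R) : d != 0 -> d * (theta / d * s) = theta * s.
  by move=> d0; field.
rewrite {1}/p /limit_seq clear_den // big_nat_recl // subn0 big_geq // mulr1 mulrDr addrC.
congr (_ + _); rewrite /p /limit_seq mulrCA -mulrA; congr (_ * _).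
rewrite !mulr_sumr; apply: eq_bigr => i _.
rewrite subSS big_nat_recl //.
have -> : \prod_(1 <= j < i.+1)
     ((k.+1%:R - j.+1%:R + delta) / (k.+1%:R - j.+1%:R + delta + theta)) =
  \prod_(1 <= j < i.+1) ((k%:R - j%:R + delta) / (k%:R - j%:R + delta + theta)).
  apply: eq_bigr => j _; rewrite -natr1 -[j.+1%:R]natr1.
  by congr (_ / _); ring.
have -> : k.+1%:R - 1 = k%:R :> R by rewrite -natr1 addrK.
by ring.
Qed.

Lemma limit_seq_min : (m%:R + delta + theta) * p m = theta * r m.
Proof.
have hm := shifted_gt0 (leqnn m); have t1 := theta_gt1.
have n1 : m%:R + delta + theta != 0 by rewrite gt_eqF //; lra.
have clear_den (d s : R) : d != 0 -> d * (theta / d * s) = theta * s.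
  by move=> d0; field.
rewrite /p /limit_seq clear_den //; congr (_ * _).
case: (m) m_gt0 r_small => // m' _ rs.
rewrite big_nat_recl // subn0 big_geq // mulr1 big_nat big1 ?addr0 // => i /andP[_ im].
by rewrite rs ?mul0r // subSS ltnS leq_subr.
Qed.

Lemma limit_seq_rec k : theta * (p k - r k) =
  (if k is k'.+1 then (k'%:R + delta) * p k' else 0) - (k%:R + delta) * p k.
Proof.
have [km|mk] := ltnP k m.
  rewrite limit_seq_small // r_small //.
  case: k km => [|k] km; first by ring.
  by rewrite limit_seq_small 1?ltnW //; ring.
case: k mk => [|k] mk; first by move: m_gt0; rewrite ltnNge mk.
have [mk'|km] := leqP m k.
  by have := limit_seq_step mk'; lra.
have E : m = k.+1 by apply/eqP; rewrite eqn_leq mk km.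
have := limit_seq_min; rewrite (limit_seq_small km) E; lra.
Qed.

Lemma limit_seq_ge0 k : 0 <= p k.
Proof.
have t1 := theta_gt1.
elim: k => [|k IH]; first by rewrite limit_seq_small.
have [km|mk] := ltnP k.+1 m; first by rewrite limit_seq_small.
have d1 := shifted_gt0 mk.
have h : 0 <= (k%:R + delta) * p k.
  have [km|mk'] := ltnP k m; first by rewrite limit_seq_small // mulr0.
  by rewrite mulr_ge0 // ltW // shifted_gt0.
have E := limit_seq_rec k.+1; have r0 := r_ge0 k.+1.
have : 0 <= (k.+1%:R + delta + theta) * p k.+1.
  have : 0 <= theta * r k.+1 by rewrite mulr_ge0 //; lra.
  by lra.
by rewrite pmulr_rge0 //; lra.
Qed.

Lemma flux_ge0 k : 0 <= (k%:R + delta) * p k.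
Proof.
have [km|mk] := ltnP k m; first by rewrite limit_seq_small // mulr0.
by rewrite mulr_ge0 ?limit_seq_ge0 // ltW // shifted_gt0.
Qed.

(** Summing the stationarity equation telescopes to the nonpositive number
    -(K-1 + delta) p_(K-1), so p has no more mass than r. *)
Lemma limit_seq_sum K : \sum_(k < K) p k <= 1.
Proof.
have t1 := theta_gt1.
apply: le_trans (r_sum K); rewrite -subr_le0 -sumrB.
have t0 : 0 < theta by lra.
rewrite -(pmulr_rle0 _ t0) mulr_sumr.
have E k : \sum_(i < k.+1) theta * (p i - r i) = - ((k%:R + delta) * p k).
  elim: k => [|k IH]; first by rewrite big_ord_recr big_ord0 /= limit_seq_rec; ring.
  by rewrite big_ord_recr /= IH limit_seq_rec; ring.
by case: K => [|K]; rewrite ?big_ord0 // E oppr_le0 flux_ge0.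
Qed.

Lemma init_mass_le1 k : r k <= 1.
Proof. by apply: le_trans (r_sum k.+1); rewrite big_ord_recr /= lerDr sumr_ge0. Qed.

(** As theta >= 1, the recursion shows that f_k = p_k a_k a_(k+1), with
    a_k = k + delta, increases by at most theta r_k a_k at each step, and the
    sum of r_k a_k is at most mu + |delta|.  The exponent 2 is thus available
    with a first moment only. *)
Lemma limit_seq_decay k : p k * (k%:R + delta) ^+ 2 <= theta * (mu + `|delta|).
Proof.
have t1 := theta_gt1.
pose f k := p k * ((k%:R + delta) * (k.+1%:R + delta)).
have step i : f i <= theta * \sum_(j < i.+1) r j * (j%:R + delta).
  elim: i => [|i IH].
    rewrite /f limit_seq_small // mul0r big_ord_recr big_ord0 /=.
    by rewrite r_small // mul0r addr0 mulr0.
  rewrite big_ord_recr /= mulrDr -lerBlDr; apply: le_trans IH.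
  have [im|mi] := ltnP i.+1 m.
    by rewrite /f (limit_seq_small im) (limit_seq_small (ltnW im)) (r_small im) !mul0r mulr0 subr0.
  have d1 := shifted_gt0 mi; have E := limit_seq_rec i.+1; rewrite /= in E.
  have fl := flux_ge0 i; have p0 := limit_seq_ge0 i.+1.
  have : p i.+1 * (i.+1%:R + delta + 1) <= (i%:R + delta) * p i + theta * r i.+1.
    have : p i.+1 * 1 <= p i.+1 * theta by rewrite ler_wpM2l // ltW.
    by lra.
  move=> h; have d2 := shifted_gt0 (leqW mi).
  have := ler_wpM2r (ltW d1) h; rewrite /f -[i.+2%:R]natr1 -[i.+1%:R]natr1.
  by lra.
have [km|mk] := ltnP k m.
  rewrite limit_seq_small // mul0r mulr_ge0 //; first by lra.
  by rewrite addr_ge0 // (le_trans _ (r_mean 0)) // big_ord0.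
have dk := shifted_gt0 mk.
apply: (@le_trans _ _ (f k)).
  rewrite /f expr2 ler_wpM2l ?limit_seq_ge0 // ler_wpM2l ?(ltW dk) //.
  by rewrite lerD2r ler_nat.
apply: le_trans (step k) _; rewrite ler_wpM2l //; first by lra.
under eq_bigr do rewrite mulrDr.
rewrite big_split /= -mulr_suml lerD //.
  by under eq_bigr do rewrite mulrC; apply: r_mean.
apply: (@le_trans _ _ ((\sum_(i < k.+1) r i) * `|delta|)).
  by rewrite ler_wpM2l ?ler_norm // sumr_ge0.
by rewrite ler_piMl.
Qed.

Lemma limit_seq_law : limit_law delta theta (theta * (mu + `|delta|)) limit_seq r.
Proof.
split.
- exact: limit_seq_ge0.
- exact: limit_seq_sum.
- by move=> k; rewrite r_ge0 init_mass_le1.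
- exact: limit_seq_rec.
- move=> k; have [km|mk _] := ltnP k m; first by rewrite -/p (limit_seq_small km) eqxx.
  exact/ltW/shifted_gt0.
- exact: limit_seq_decay.
Qed.

End LimitSequence.

(** * One step of the degree sequence *)

Lemma sumr_pick (R : nzRingType) K (f : nat -> R) (i : nat) :
  \sum_(k < K) (i == k)%:R * f k = if (i < K)%N then f i else 0.
Proof.
case: ltnP => [iK|Ki].
  rewrite (bigD1 (Ordinal iK)) //= eqxx mul1r big1 ?addr0 // => k nk.
  rewrite -val_eqE /= eq_sym in nk; by rewrite (negbTE nk) mul0r.
rewrite big1 // => k _; case: eqP => [E|_]; last by rewrite mul0r.
by move: (ltn_ord k); rewrite -E ltnNge Ki.
Qed.

Section RealSums.
Context {R : realFieldType}.

Lemma sumr_sqr_le_sqr_sum K (y : nat -> R) :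
  \sum_(k < K) y k ^+ 2 <= (\sum_(k < K) `|y k|) ^+ 2.
Proof.
elim: K => [|K IH]; first by rewrite !big_ord0 expr0n.
rewrite !big_ord_recr /= sqrrD -(real_normK (num_real (y K))).
rewrite lerD2r; apply: le_trans IH _; rewrite lerDl mulrn_wge0 // mulr_ge0 //.
by apply: sumr_ge0.
Qed.

(** By v_j v_k <= (v_j^2 + v_k^2)/2 and the two summations. *)
Lemma schur_test K (M : nat -> nat -> R) (v : nat -> R) :
  (forall j k, 0 <= M j k) ->
  (forall j : 'I_K, \sum_(k < K) M j k <= 1) ->
  (forall k : 'I_K, \sum_(j < K) M j k <= 1) ->
  \sum_(k < K) v k * (\sum_(j < K) v j * M j k) <= \sum_(k < K) v k ^+ 2.
Proof.
move=> M0 row col.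
apply: (@le_trans _ _ (\sum_(k < K) \sum_(j < K)
    (v k ^+ 2 * M j k / 2 + v j ^+ 2 * M j k / 2))).
  apply: ler_sum => k _; rewrite mulr_sumr; apply: ler_sum => j _.
  have := M0 j k; have := sqr_ge0 (v k - v j).
  by move: (M j k) (v k) (v j) => m a b h1 h2; nra.
under eq_bigr do rewrite big_split /=.
rewrite big_split /= [X in _ + X]exchange_big /=.
have -> : \sum_(k < K) v k ^+ 2 =
   \sum_(k < K) v k ^+ 2 / 2 + \sum_(k < K) v k ^+ 2 / 2.
  by rewrite -big_split /=; apply: eq_bigr => k _; lra.
apply: lerD; apply: ler_sum => k _; rewrite -mulr_suml -mulr_sumr.
  by rewrite ler_pM2r ?invr_gt0 // ler_piMr ?sqr_ge0.
by rewrite ler_pM2r ?invr_gt0 // ler_piMr ?sqr_ge0.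
Qed.

End RealSums.

Section Load.
Context {R : realFieldType} (I : finType) (q : I -> R).
Hypothesis q1 : \sum_i q i = 1.

Definition load c (x : {ffun 'I_c -> I}) (i : I) : nat := (\sum_(e < c) (x e == i))%N.

Definition choice_weight c (x : {ffun 'I_c -> I}) : R := \prod_(e < c) q (x e).

Lemma sum_choice_weight c : \sum_x choice_weight (c := c) x = 1.
Proof.
by rewrite /choice_weight -(bigA_distr_bigA (fun _ => q)) /= big1.
Qed.

Lemma sum_load c (x : {ffun 'I_c -> I}) : (\sum_i load x i)%N = c.
Proof.
rewrite /load exchange_big /= -[RHS]card_ord -sum1_card; apply: eq_bigr => e _.
rewrite (bigD1 (x e)) //= eqxx big1 ?addn0 // => i.
by rewrite eq_sym => /negbTE ->.
Qed.

(** Expanding the c-th power of sum_j q_j X^[j = i] gives the generating function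
    of the load of i, and that sum is [binpoly (q i)]. *)
Lemma load_distribution c i l :
  \sum_(x : {ffun 'I_c -> I}) choice_weight x * (load x i == l)%:R
  = binpmf (q i) c l.
Proof.
have gen : \sum_(x : {ffun 'I_c -> I}) (choice_weight x)%:P * 'X^(load x i)
         = binpoly (q i) ^+ c.
  transitivity (\prod_(e < c) \sum_j (q j)%:P * 'X^(j == i)).
    rewrite bigA_distr_bigA /=; apply: eq_bigr => x _.
    by rewrite big_split /= -rmorph_prod -prodrXr.
  rewrite prodr_const card_ord; congr (_ ^+ _).
  rewrite (bigD1 i) //= eqxx expr1 /binpoly addrC; congr (_ + _).
  have -> : 1 - q i = \sum_(j | j != i) q j.
    by rewrite -q1 (bigD1 i) //= addrAC subrr add0r.
  rewrite raddf_sum /=.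
  by apply: eq_bigr => j /negbTE ->; rewrite expr0 mulr1.
rewrite /binpmf -gen coef_sum; apply: eq_bigr => x _.
by rewrite coefCM coefXn eq_sym.
Qed.

End Load.

Section Deviation.
Context {R : realFieldType}.

Definition next_degree n (dg : 'I_n.+1 -> nat) c (x : {ffun 'I_c -> 'I_n.+1})
    (i : 'I_n.+2) : nat :=
  if unlift ord_max i is Some j then (dg j + load x j)%N else c.

Definition degree_count n (dg : 'I_n.+1 -> nat) (k : nat) : R :=
  \sum_i (dg i == k)%:R.

Definition deviation (p : nat -> R) n (dg : 'I_n.+1 -> nat) (k : nat) : R :=
  degree_count dg k - n.+1%:R * p k.

Definition sq_deviation (p : nat -> R) K n (dg : 'I_n.+1 -> nat) : R :=
  \sum_(k < K) deviation p dg k ^+ 2.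

Definition attach_weight (delta : R) n (dg : 'I_n.+1 -> nat) (i : 'I_n.+1) : R :=
  ((dg i)%:R + delta) / \sum_j ((dg j)%:R + delta).

Lemma next_degree_widen n (dg : 'I_n.+1 -> nat) c (x : {ffun 'I_c -> 'I_n.+1}) i :
  next_degree dg x (widen_ord (leqnSn _) i) = (dg i + load x i)%N.
Proof.
have -> : widen_ord (leqnSn n.+1) i = lift ord_max i.
  by apply: val_inj => /=; rewrite /bump leqNgt ltn_ord.
by rewrite /next_degree liftK.
Qed.

Lemma next_degree_max n (dg : 'I_n.+1 -> nat) c (x : {ffun 'I_c -> 'I_n.+1}) :
  next_degree dg x ord_max = c.
Proof. by rewrite /next_degree unlift_none. Qed.

Lemma degree_count_next n (dg : 'I_n.+1 -> nat) c (x : {ffun 'I_c -> 'I_n.+1}) k :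
  degree_count (next_degree dg x) k = \sum_i (dg i + load x i == k)%N%:R + (c == k)%:R.
Proof.
rewrite /degree_count big_ord_recr /= next_degree_max; congr (_ + _).
by apply: eq_bigr => i _; rewrite next_degree_widen.
Qed.

Definition step_constant (theta Cp kappa : R) : R :=
  32 + 12 * Cp / kappa ^+ 2 + 4 * theta / kappa.

End Deviation.

Section OneStep.
Context {R : realFieldType}.
Variables (n : nat) (dg : 'I_n.+1 -> nat) (delta theta kappa Cp : R).
Variables (p r : nat -> R).
Hypothesis kappa_gt0 : 0 < kappa.
Hypothesis dg_ge : forall i, kappa <= (dg i)%:R + delta.
Hypothesis theta_ge0 : 0 <= theta.
Hypothesis law : limit_law delta theta Cp p r.

Let p_ge0 := law_ge0 law.
Let p_sum := law_sum law.
Let r_itv := law_init law.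
Let p_rec := law_rec law.
Let p_pos := law_pos law.
Let p_decay := law_decay law.

Let S : R := \sum_i ((dg i)%:R + delta).
Let q := attach_weight delta dg.

Let S_ge : n.+1%:R * kappa <= S.
Proof.
rewrite mulr_natl -[n.+1]card_ord -sumr_const; apply: ler_sum => i _; exact: dg_ge.
Qed.

Let S_gt0 : 0 < S.
Proof. by apply: lt_le_trans S_ge; rewrite mulr_gt0. Qed.

Let q_sum : \sum_i q i = 1.
Proof. by rewrite /q /attach_weight -mulr_suml divff // gt_eqF. Qed.

Let q_ge0 i : 0 <= q i.
Proof. by rewrite divr_ge0 ?(ltW S_gt0) // (le_trans (ltW kappa_gt0)). Qed.

Let q_le1 i : q i <= 1.
Proof. by rewrite -q_sum (bigD1 i) //= lerDl sumr_ge0. Qed.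

Let qq (j : nat) : R := clamp01 ((j%:R + delta) / S).

Let qq_dg i : qq (dg i) = q i.
Proof. by rewrite /qq clamp01_id // q_ge0 q_le1. Qed.

Let qq_itv j : 0 <= qq j <= 1.
Proof. exact: clamp01_itv. Qed.

Variable c : nat.
Hypothesis c_gt0 : (0 < c)%N.

(** The transition matrix of the degrees, the clamped attachment probability
    making it meaningful for every j. *)
Let M j k : R := if (j <= k)%N then binpmf (qq j) c (k - j) else 0.

Let transition_ge0 j k : 0 <= M j k.
Proof. by rewrite /M; case: ifP => // _; apply: binpmf_ge0. Qed.

Lemma transition_row_sum K j : \sum_(k < K) M j k <= 1.
Proof.
have [Kj|jK] := leqP K j.
  rewrite big1 // => k _; rewrite /M leqNgt (leq_trans (ltn_ord k) Kj) //.
rewrite -(big_mkord xpredT (M j)) (big_cat_nat (n := j)) //=; last exact: ltnW.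
rewrite big_nat big1 ?add0r => [|k /andP[_ kj]]; last by rewrite /M leqNgt kj.
rewrite -{1}[j]add0n big_addn big_mkord.
under eq_bigr => l _ do rewrite /M leq_addl addnK.
by rewrite sum_binpmf gerBl bintail_ge0.
Qed.

(** Summing over the jump l = k - j is the form suited to
    [binpmf_linearization]. *)
Lemma transition_col_reindex K k (y : nat -> R) : (k < K)%N ->
  \sum_(j < K) y j * M j k = \sum_(l < k.+1) y (k - l)%N * binpmf (qq (k - l)) c l.
Proof.
move=> kK; rewrite -(big_mkord xpredT (fun j => y j * M j k)).
rewrite (big_cat_nat (n := k.+1)) //= [X in _ + X]big_nat.
rewrite [X in _ + X]big1 ?addr0 => [|j /andP[kj _]]; last first.
  by rewrite /M leqNgt kj mulr0.
rewrite big_mkord (reindex_inj rev_ord_inj) /=; apply: eq_bigr => l _.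
by rewrite /M subSS leq_subr subKn // -ltnS.
Qed.

(** In terms of tails the column sum is sum_j (T_j(k-j) - T_j(k-j+1)).  Since
    q_j <= q_(j+1), T_j(k-j) is at most T_(j+1)(k-j), which is the subtracted
    term of index j+1, so the sum telescopes. *)
Lemma transition_col_sum K (k : 'I_K) : \sum_(j < K) M j k <= 1.
Proof.
have -> : \sum_(j < K) M j k = \sum_(j < k.+1) binpmf (qq j) c (k - j).
  have := @transition_col_reindex K k (fun=> 1) (ltn_ord k).
  under eq_bigr do rewrite mul1r; move=> ->.
  rewrite (reindex_inj rev_ord_inj) /=; apply: eq_bigr => l _.
  by rewrite mul1r subSS subKn // -ltnS.
suff key i : (i <= k)%N ->
    \sum_(j < i.+1) binpmf (qq j) c (k - j) <= bintail (qq i) c (k - i).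
  by apply: le_trans (key k _) _ => //; apply: bintail_le1.
elim: i => [|i IH] ik.
  by rewrite big_ord_recr big_ord0 /= add0r binpmfE gerBl bintail_ge0.
rewrite big_ord_recr /=; apply: le_trans (lerD (IH (ltnW ik)) (lexx _)) _.
rewrite binpmfE -subSn // subSS addrCA gerDl subr_le0.
have /andP[h0 _] := qq_itv i; have /andP[_ h1] := qq_itv i.+1.
apply: bintail_mono => //; apply: clamp01_mono.
by rewrite ler_pM2r ?invr_gt0 // lerD2r ler_nat.
Qed.

(** By [binpmf_linearization] the jump l from degree k - l contributes at most
    p_(k-l) c^2 (a_(k-l) / S)^2 times its weight, and p_j a_j^2 <= Cp. *)
Lemma stationarity_error K k : (k < K)%N ->
  `| \sum_(j < K) p j * M j k - p k - c%:R / S * (theta * (p k - r k)) |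
  <= 3 * Cp * c%:R ^+ 2 / S ^+ 2.
Proof.
move=> kK; rewrite transition_col_reindex //.
pose x j := (j%:R + delta) / S.
have -> : \sum_(l < k.+1) p (k - l)%N * binpmf (qq (k - l)) c l - p k
          - c%:R / S * (theta * (p k - r k)) =
  \sum_(l < k.+1) p (k - l)%N * (binpmf (qq (k - l)) c l - (l == 0%N :> nat)%:R
     - c%:R * x (k - l)%N * ((l == 1%N :> nat)%:R - (l == 0%N :> nat)%:R)).
  rewrite p_rec.
  have -> : \sum_(l < k.+1) p (k - l)%N * (binpmf (qq (k - l)) c l - (l == 0%N :> nat)%:R
     - c%:R * x (k - l)%N * ((l == 1%N :> nat)%:R - (l == 0%N :> nat)%:R)) =
    \sum_(l < k.+1) p (k - l)%N * binpmf (qq (k - l)) c l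
    - \sum_(l < k.+1) (0%N == l :> nat)%:R * p (k - l)%N
    - c%:R / S * (\sum_(l < k.+1) (1%N == l :> nat)%:R * (((k - l)%:R + delta) * p (k - l)%N)
      - \sum_(l < k.+1) (0%N == l :> nat)%:R * (((k - l)%:R + delta) * p (k - l)%N)).
    rewrite -!sumrB mulr_sumr -sumrB; apply: eq_bigr => l _.
    by rewrite /x ![nat_of_ord l == _]eq_sym; ring.
  rewrite (@sumr_pick _ _ (fun l => p (k - l)%N)).
  rewrite !(@sumr_pick _ _ (fun l => ((k - l)%:R + delta) * p (k - l)%N)).
  by rewrite /= !subn0; case: k {kK} => [|k] /=; rewrite ?subn1.
apply: le_trans (ler_norm_sum _ _ _) _.
apply: (@le_trans _ _ (\sum_(l < k.+1) Cp * c%:R ^+ 2 / S ^+ 2 * jump_weight l)).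
  apply: ler_sum => l _; have [->|pn0] := eqVneq (p (k - l)%N) 0.
    rewrite mul0r normr0 !mulr_ge0 ?sqr_ge0 ?invr_ge0 ?sqr_ge0 ?jump_weight_ge0 //.
    by apply: le_trans (p_decay 0); rewrite mulr_ge0 ?sqr_ge0.
  rewrite normrM ger0_norm //.
  have x0 : 0 <= x (k - l)%N by rewrite divr_ge0 ?p_pos // ltW.
  apply: le_trans (ler_wpM2l (p_ge0 _) (binpmf_linearization l x0 c_gt0)) _.
  rewrite mulrA ler_wpM2r ?jump_weight_ge0 //.
  have -> : p (k - l)%N * (c%:R ^+ 2 * x (k - l)%N ^+ 2)
     = (p (k - l)%N * ((k - l)%:R + delta) ^+ 2) * (c%:R ^+ 2 / S ^+ 2).
    by rewrite /x expr_div_n; ring.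
  by rewrite -[leRHS]mulrA ler_wpM2r ?mulr_ge0 ?sqr_ge0 ?invr_ge0 ?sqr_ge0.
rewrite -mulr_sumr.
have Cp0 : 0 <= Cp by apply: le_trans (p_decay 0); rewrite mulr_ge0 ?sqr_ge0.
have -> : 3 * Cp * c%:R ^+ 2 / S ^+ 2 = Cp * c%:R ^+ 2 / S ^+ 2 * 3 by ring.
by rewrite ler_wpM2l ?sum_jump_weight // !mulr_ge0 ?sqr_ge0 ?invr_ge0 ?sqr_ge0.
Qed.

Let N : nat -> R := degree_count dg.
Let v : nat -> R := deviation p dg.
Let N' (x : {ffun 'I_c -> 'I_n.+1}) (k : nat) : R :=
  \sum_i (dg i + load x i == k)%N%:R + (c == k)%:R.

Lemma sum_indicator_le K (i : nat) : \sum_(k < K) (i == k)%:R <= 1 :> R.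
Proof.
have := @sumr_pick R K (fun=> 1) i.
by under eq_bigr do rewrite mulr1; move=> ->; case: ifP.
Qed.

Lemma sum_degree_count K : \sum_(k < K) N k <= n.+1%:R.
Proof.
rewrite /N /degree_count exchange_big /=.
apply: (@le_trans _ _ (\sum_(i < n.+1) 1)).
  by apply: ler_sum => i _; apply: sum_indicator_le.
by rewrite sumr_const card_ord.
Qed.

Lemma degree_count_ge0 k : 0 <= N k. Proof. exact: sumr_ge0. Qed.

Lemma sum_abs_deviation K : \sum_(k < K) `|v k| <= 2 * n.+1%:R.
Proof.
apply: (@le_trans _ _ (\sum_(k < K) (N k + n.+1%:R * p k))).
  apply: ler_sum => k _; rewrite (le_trans (ler_normB _ _)) //.
  by rewrite (ger0_norm (degree_count_ge0 k)) ger0_norm // mulr_ge0.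
rewrite big_split /= -mulr_sumr [2 * _]mulr_natl mulr2n lerD ?sum_degree_count //.
by rewrite ler_piMr // p_sum.
Qed.

Lemma sum_next_degree_count x K : \sum_(k < K) N' x k <= n.+2%:R.
Proof.
rewrite big_split /= -natr1 lerD ?sum_indicator_le // exchange_big /=.
apply: (@le_trans _ _ (\sum_(i < n.+1) 1)).
  by apply: ler_sum => i _; apply: sum_indicator_le.
by rewrite sumr_const card_ord.
Qed.

(** The l1 norm of a deviation never exceeds twice the number of vertices.  This
    replaces [sum_abs_increment] when c is large compared to n. *)
Lemma next_deviation_crude x K :
  \sum_(k < K) (N' x k - n.+2%:R * p k) ^+ 2 <= (2 * n.+2%:R) ^+ 2.
Proof.
apply: le_trans (sumr_sqr_le_sqr_sum K (fun k => N' x k - n.+2%:R * p k)) _.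
rewrite ler_sqr ?nnegrE ?sumr_ge0 // ?mulr_ge0 //.
apply: (@le_trans _ _ (\sum_(k < K) (N' x k + n.+2%:R * p k))).
  apply: ler_sum => k _; rewrite (le_trans (ler_normB _ _)) //.
  rewrite !ger0_norm ?mulr_ge0 //; by rewrite addr_ge0 ?sumr_ge0.
rewrite big_split /= -mulr_sumr [2 * _]mulr_natl mulr2n lerD ?sum_next_degree_count //.
by rewrite ler_piMr // p_sum.
Qed.

Let D x k := N' x k - N k - p k.

(** Each of the c new edges changes the degree of at most one old vertex, which
    leaves one class and enters another; the new vertex and the shift of (n+1) p
    by p contribute at most 1 each. *)
Lemma sum_abs_increment x K : \sum_(k < K) `|D x k| <= 2 * c%:R + 2.
Proof.
apply: (@le_trans _ _ (\sum_(k < K) (\sum_i `|(dg i + load x i == k)%N%:R - (dg i == k)%:R|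
   + (c == k)%:R + p k))).
  apply: ler_sum => k _; rewrite /D /N' /N /degree_count [X in X - p k]addrAC -sumrB.
  apply: le_trans (ler_normB _ _) _; rewrite (ger0_norm (p_ge0 k)) lerD2r.
  apply: le_trans (ler_normD _ _) _; rewrite normr_nat lerD2r.
  exact: ler_norm_sum.
rewrite !big_split /= -addrA; apply: lerD; last first.
  by rewrite -[leRHS]/(1 + 1); rewrite lerD ?p_sum ?sum_indicator_le.
rewrite exchange_big /= -[in leRHS](sum_load x) natr_sum mulr_sumr; apply: ler_sum => i _.
case: (load x i) => [|l].
  by rewrite addn0 mulr0 big1 // => k _; rewrite subrr normr0.
apply: (@le_trans _ _ 2); last by rewrite ler_peMr // ler1n.
apply: (@le_trans _ _ (\sum_(k < K) ((dg i + l.+1 == k)%N%:R + (dg i == k)%:R))).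
  by apply: ler_sum => k _; rewrite (le_trans (ler_normB _ _)) // !normr_nat.
by rewrite big_split /= -[2]/(1 + 1) lerD // sum_indicator_le.
Qed.

Lemma mean_next_degree_count K k : (k < K)%N ->
  \sum_x choice_weight q x * N' x k = \sum_(j < K) N j * M j k + (c == k)%:R.
Proof.
move=> kK; under eq_bigr do rewrite mulrDr.
rewrite big_split /= -mulr_suml sum_choice_weight // mul1r; congr (_ + _).
under eq_bigr do rewrite mulr_sumr.
rewrite exchange_big /=.
rewrite /N /degree_count; under [RHS]eq_bigr do rewrite mulr_suml.
rewrite [RHS]exchange_big /=; apply: eq_bigr => i _.
rewrite (@sumr_pick _ _ (fun j => M j k)).
have -> : (if (dg i < K)%N then M (dg i) k else 0) = M (dg i) k.
  case: ltnP => // Kd; rewrite /M leqNgt (leq_trans kK) //.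
rewrite /M qq_dg; case: leqP => [dk|kd].
  rewrite -load_distribution //; apply: eq_bigr => x _.
  by rewrite -{1}(subnKC dk) eqn_add2l.
rewrite big1 // => x _; case: eqP => [E|]; rewrite ?mulr0 //.
by move: kd; rewrite -E ltnNge leq_addr.
Qed.

(** The part of <v, E D> that only becomes small when averaged over c. *)
Let drift K : R := n.+1%:R * (c%:R / S) * theta * (\sum_(k < K) v k * (p k - r k))
   + (\sum_(k < K) v k * (c == k)%:R) - \sum_(k < K) v k * p k.

(** With N = v + (n+1) p, the mean increment is (Q^T - 1) v + (n+1) (Q^T p - p)
    plus the newborn vertex minus p.  The first term pairs nonpositively with v,
    and [stationarity_error] evaluates the second. *)
Lemma mean_increment_pairing K :
  \sum_(k < K) v k * (\sum_x choice_weight q x * D x k) <=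
  drift K + 6 * Cp / kappa ^+ 2 * c%:R ^+ 2.
Proof.
pose u k := \sum_(j < K) p j * M j k - p k - c%:R / S * (theta * (p k - r k)).
have E (k : 'I_K) : \sum_x choice_weight q x * D x k =
   (\sum_(j < K) v j * M j k) - v k + n.+1%:R * u k
   + n.+1%:R * (c%:R / S) * theta * (p k - r k) + (c == k)%:R - p k.
  rewrite /D; under eq_bigr do rewrite !mulrBr.
  rewrite !sumrB -!mulr_suml sum_choice_weight // !mul1r (@mean_next_degree_count K) //.
  have -> : \sum_(j < K) v j * M j k = \sum_(j < K) N j * M j k
       - n.+1%:R * \sum_(j < K) p j * M j k.
    by rewrite mulr_sumr -sumrB; apply: eq_bigr => j _; rewrite /v /deviation -/N; ring.
  by rewrite /u /v /deviation -/N; ring.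
under eq_bigr => k _ do rewrite E.
have -> : \sum_(k < K) v k * ((\sum_(j < K) v j * M j k) - v k + n.+1%:R * u k
   + n.+1%:R * (c%:R / S) * theta * (p k - r k) + (c == k)%:R - p k) =
   (\sum_(k < K) v k * (\sum_(j < K) v j * M j k) - \sum_(k < K) v k ^+ 2)
   + n.+1%:R * \sum_(k < K) v k * u k + drift K.
  rewrite /drift !mulr_sumr -!sumrB -!big_split /= -sumrB -big_split /=.
  by apply: eq_bigr => k _; ring.
rewrite addrC lerD2l -[leRHS]add0r; apply: lerD.
  by rewrite subr_le0; apply: schur_test => // *; [apply: transition_row_sum|apply: transition_col_sum].
pose b := 3 * Cp * c%:R ^+ 2 / S ^+ 2.
have Cp0 : 0 <= Cp by apply: le_trans (p_decay 0); rewrite mulr_ge0 ?sqr_ge0.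
have b0 : 0 <= b by rewrite !mulr_ge0 ?sqr_ge0 ?invr_ge0 ?sqr_ge0.
have h : \sum_(k < K) v k * u k <= 2 * n.+1%:R * b.
  apply: (@le_trans _ _ (\sum_(k < K) `|v k| * b)).
    apply: ler_sum => k _; apply: le_trans (ler_norm _) _.
    by rewrite normrM ler_wpM2l // stationarity_error.
  by rewrite -mulr_suml ler_wpM2r // sum_abs_deviation.
apply: le_trans (ler_wpM2l _ h) _ => //.
have -> : n.+1%:R * (2 * n.+1%:R * b) = 6 * Cp * c%:R ^+ 2 * (n.+1%:R / S) ^+ 2.
  by rewrite /b expr_div_n; ring.
have -> : 6 * Cp / kappa ^+ 2 * c%:R ^+ 2 = 6 * Cp * c%:R ^+ 2 * kappa^-1 ^+ 2.
  by rewrite exprVn; ring.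
rewrite ler_wpM2l ?mulr_ge0 ?sqr_ge0 //.
rewrite ler_sqr ?nnegrE ?divr_ge0 ?invr_ge0 ?(ltW S_gt0) ?(ltW kappa_gt0) //.
by rewrite ler_pdivrMr // ler_pdivlMl // mulrC.
Qed.

Lemma one_step_small K :
  \sum_x choice_weight q x * (\sum_(k < K) (N' x k - n.+2%:R * p k) ^+ 2)
  <= \sum_(k < K) v k ^+ 2 + 2 * drift K + (16 + 12 * Cp / kappa ^+ 2) * c%:R ^+ 2.
Proof.
have w0 x : 0 <= choice_weight q x by apply: prodr_ge0.
have E x : \sum_(k < K) (N' x k - n.+2%:R * p k) ^+ 2 =
   \sum_(k < K) v k ^+ 2 + 2 * (\sum_(k < K) v k * D x k) + \sum_(k < K) D x k ^+ 2.
  rewrite mulr_sumr -!big_split /=; apply: eq_bigr => k _.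
  by rewrite /v /deviation -/N /D -natr1; ring.
have sq x : \sum_(k < K) D x k ^+ 2 <= 16 * c%:R ^+ 2.
  apply: le_trans (sumr_sqr_le_sqr_sum K (D x)) _.
  have c1 : 1 <= c%:R :> R by rewrite ler1n.
  have -> : 16 * c%:R ^+ 2 = (4 * c%:R) ^+ 2 :> R by ring.
  rewrite ler_sqr ?nnegrE ?sumr_ge0 // ?mulr_ge0 //.
  by apply: le_trans (sum_abs_increment x K) _; lra.
apply: (@le_trans _ _ (\sum_x choice_weight q x * (\sum_(k < K) v k ^+ 2
     + 2 * (\sum_(k < K) v k * D x k) + 16 * c%:R ^+ 2))).
  by apply: ler_sum => x _; rewrite ler_wpM2l // E lerD2l.
have -> : \sum_x choice_weight q x * (\sum_(k < K) v k ^+ 2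
     + 2 * (\sum_(k < K) v k * D x k) + 16 * c%:R ^+ 2) =
   \sum_(k < K) v k ^+ 2 + 16 * c%:R ^+ 2
   + 2 * \sum_(k < K) v k * (\sum_x choice_weight q x * D x k).
  under eq_bigr do rewrite addrAC mulrDr.
  rewrite big_split /= -mulr_suml sum_choice_weight // mul1r; congr (_ + _).
  under eq_bigr do rewrite mulrCA mulr_sumr.
  rewrite -mulr_sumr exchange_big /=; congr (_ * _); apply: eq_bigr => k _.
  by rewrite mulr_sumr; apply: eq_bigr => x _; rewrite mulrCA.
by have := mean_increment_pairing K; lra.
Qed.

(** For c <= n+1 this is [one_step_small].  For larger c the crude bound 4 (n+2)^2
    on the left, and the bounds O(c (n+1)) on the terms on the right, suffice. *)
Lemma one_step K :
  \sum_(x : {ffun 'I_c -> 'I_n.+1})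
     choice_weight (attach_weight delta dg) x * sq_deviation p K (next_degree dg x)
  <= sq_deviation p K dg
     + 2 * (n.+1%:R * (c%:R / \sum_i ((dg i)%:R + delta)) * theta
              * (\sum_(k < K) deviation p dg k * (p k - r k))
            + \sum_(k < K) deviation p dg k * (c == k)%:R
            - \sum_(k < K) deviation p dg k * p k)
     + step_constant theta Cp kappa * (c * minn c n.+1)%:R.
Proof.
rewrite /step_constant.
have next_dev x : sq_deviation p K (next_degree dg x) =
    \sum_(k < K) (N' x k - n.+2%:R * p k) ^+ 2.
  by apply: eq_bigr => k _; rewrite /deviation degree_count_next.
under eq_bigr do rewrite next_dev.
rewrite /sq_deviation -/S -/v -/q -/(drift K).
have Cp0 : 0 <= Cp by apply: le_trans (p_decay 0); rewrite mulr_ge0 ?sqr_ge0.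
have tk0 : 0 <= theta / kappa by rewrite divr_ge0 // ltW.
have ck0 : 0 <= Cp / kappa ^+ 2 by rewrite divr_ge0 // sqr_ge0.
have [cn|nc] := leqP c n.+1.
  apply: le_trans (one_step_small K) _; rewrite lerD2l natrM -expr2.
  by rewrite ler_wpM2r ?sqr_ge0 //; lra.
apply: (@le_trans _ _ ((2 * n.+2%:R) ^+ 2)).
  apply: (@le_trans _ _ (\sum_x choice_weight q x * (2 * n.+2%:R) ^+ 2)); last first.
    by rewrite -mulr_suml sum_choice_weight // mul1r.
  apply: ler_sum => x _; rewrite ler_wpM2l ?next_deviation_crude //.
  exact: prodr_ge0.
have sv0 : 0 <= \sum_(k < K) v k ^+ 2 by apply: sumr_ge0 => k _; apply: sqr_ge0.
have d1 : `|\sum_(k < K) v k * (p k - r k)| <= 2 * n.+1%:R.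
  apply: le_trans (ler_norm_sum _ _ _) _; apply: le_trans (sum_abs_deviation K).
  apply: ler_sum => k _; rewrite normrM ler_piMr //.
  have /andP[r0 r1] := r_itv k; have := p_ge0 k.
  have : p k <= 1 by apply: le_trans (p_sum k.+1); rewrite big_ord_recr /= lerDr sumr_ge0.
  by move=> p1 p0; rewrite ler_norml; apply/andP; split; lra.
have d2 : `|\sum_(k < K) v k * (c == k)%:R| <= 2 * n.+1%:R.
  apply: le_trans (ler_norm_sum _ _ _) _; apply: le_trans (sum_abs_deviation K).
  by apply: ler_sum => k _; rewrite normrM ler_piMr // normr_nat lern1 leq_b1.
have d3 : `|\sum_(k < K) v k * p k| <= 2 * n.+1%:R.
  apply: le_trans (ler_norm_sum _ _ _) _; apply: le_trans (sum_abs_deviation K).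
  apply: ler_sum => k _; rewrite normrM ler_piMr // ger0_norm //.
  by apply: le_trans (p_sum k.+1); rewrite big_ord_recr /= lerDr sumr_ge0.
have d4 : `|n.+1%:R * (c%:R / S) * theta * \sum_(k < K) v k * (p k - r k)|
     <= c%:R * (theta / kappa) * (2 * n.+1%:R).
  rewrite normrM; apply: ler_pM => //.
  rewrite ger0_norm ?mulr_ge0 ?invr_ge0 ?(ltW S_gt0) //.
  have -> : n.+1%:R * (c%:R / S) * theta = c%:R * (theta * (n.+1%:R / S)) by ring.
  rewrite ler_wpM2l // ler_wpM2l //.
  by rewrite ler_pdivrMr // ler_pdivlMl // mulrC.
have n1 : 1 <= n.+1%:R :> R by rewrite ler1n.
have nc' : n.+1%:R <= c%:R :> R by rewrite ler_nat ltnW.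
rewrite natrM /drift; move: d2 d3 d4; rewrite !ler_norml.
move: (\sum_(k < K) v k ^+ 2) sv0 => V sv0.
move: (n.+1%:R * (c%:R / S) * theta * _) => d4.
move: (\sum_(k < K) v k * (c == k)%:R) (\sum_(k < K) v k * p k) => d2 d3.
move=> /andP[h2 _] /andP[_ h3] /andP[h4 _].
rewrite -[n.+2%:R]natr1; move: (n.+1%:R : R) (c%:R : R) n1 nc' h2 h3 h4 => m C.
have -> : 4 * theta / kappa = 4 * (theta / kappa) by rewrite mulrA.
have -> : 12 * Cp / kappa ^+ 2 = 12 * (Cp / kappa ^+ 2) by rewrite mulrA.
move: (theta / kappa) (Cp / kappa ^+ 2) tk0 ck0 => a b a0 b0 m1 mC h2 h3 h4.
have Cm : m * m <= C * m by rewrite ler_wpM2r //; lra.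
have bC : 0 <= b * (C * m) by rewrite mulr_ge0 // mulr_ge0 //; lra.
by nra.
Qed.

End OneStep.

(** * Discrete random variables *)

Section Discrete.
Context {d : measure_display} {T : measurableType d}.

(** Measurability is only required of the fibers: a target such as a type of
    matrices then needs no sigma-algebra, and every set has a measurable preimage
    as soon as the target is countable. *)
Definition discrete {C : Type} (Z : T -> C) : Prop :=
  forall z, measurable (Z @^-1` [set z]).

Lemma discrete_preimage (C : countType) (Z : T -> C) (A : set C) :
  discrete Z -> measurable (Z @^-1` A).
Proof.
move=> dZ; have -> : Z @^-1` A = \bigcup_(z : C) (if z \in A then Z @^-1` [set z] else set0).
  apply/seteqP; split=> w /=.
    by move=> AZw; exists (Z w) => //; rewrite mem_set.
  by move=> [z _]; case: ifPn => //; rewrite inE => Az /= ->.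
apply: countable_bigcupT_measurable => [|z]; first exact: countableP.
by case: ifP => // _; exact: dZ.
Qed.

Lemma discrete_comp (C : countType) (D : Type) (Z : T -> C) (f : C -> D) :
  discrete Z -> discrete (f \o Z).
Proof. by move=> dZ z; apply: (@discrete_preimage _ Z (f @^-1` [set z])). Qed.

(** Handles sums with a random number of terms. *)
Lemma discrete_glue (C0 : countType) (D : Type) (Z : T -> C0) (F : C0 -> T -> D) :
  discrete Z -> (forall n, discrete (F n)) -> discrete (fun w => F (Z w) w).
Proof.
move=> dZ dF z.
have -> : (fun w => F (Z w) w) @^-1` [set z] =
    \bigcup_(n : C0) ((Z @^-1` [set n]) `&` (F n @^-1` [set z])).
  apply/seteqP; split=> w /=; first by move=> Fz; exists (Z w).
  by move=> [n _ [/= -> ]].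
apply: countable_bigcupT_measurable => [|n]; first exact: countableP.
by apply: measurableI; [exact: dZ|exact: dF].
Qed.

Lemma discrete_pair (C D : Type) (Z : T -> C) (Y : T -> D) :
  discrete Z -> discrete Y -> discrete (fun w => (Z w, Y w)).
Proof.
move=> dZ dY [z y].
have -> : (fun w => (Z w, Y w)) @^-1` [set (z, y)] =
   (Z @^-1` [set z]) `&` (Y @^-1` [set y]).
  by apply/seteqP; split=> w /= [-> ->].
exact: measurableI.
Qed.

Lemma discrete_cst (C : Type) (c : C) : discrete (fun=> c).
Proof. by move=> z; rewrite preimage_cst; case: ifP. Qed.

Lemma measurable_forall_fin (I : finType) (A : I -> set T) :
  (forall i, measurable (A i)) -> measurable [set w | forall i, A i w].
Proof.
move=> mA; have -> : [set w | forall i, A i w] = \bigcap_i A i.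
  by apply/seteqP; split=> w /= h i => [_|]; apply: h.
exact: fin_bigcap_measurable.
Qed.

Lemma discrete_ffun (I : finType) (C : Type) (Z : I -> T -> C) :
  (forall i, discrete (Z i)) -> discrete (fun w => [ffun i => Z i w]).
Proof.
move=> dZ z; have -> : (fun w => [ffun i => Z i w]) @^-1` [set z] =
    [set w | forall i, (Z i @^-1` [set z i]) w].
  apply/seteqP; split=> w /=; first by move=> <- i; rewrite ffunE.
  by move=> h; apply/ffunP => i; rewrite ffunE h.
by apply: measurable_forall_fin => i; exact: dZ.
Qed.

Lemma discrete_matrix (C : Type) m n (Z : 'I_m -> 'I_n -> T -> C) :
  (forall i j, discrete (Z i j)) -> discrete (fun w => \matrix_(i, j) Z i j w).
Proof.
move=> dZ z; have -> : (fun w => \matrix_(i, j) Z i j w) @^-1` [set z] =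
    [set w | forall i, [set w | forall j, (Z i j @^-1` [set z i j]) w] w].
  apply/seteqP; split=> w /=; first by move=> <- i j; rewrite mxE.
  by move=> h; apply/matrixP => i j; rewrite mxE h.
apply: measurable_forall_fin => i; apply: measurable_forall_fin => j; exact: dZ.
Qed.

Lemma discrete_sum (I : Type) (s : seq I) (f : I -> T -> nat) :
  (forall i, discrete (f i)) -> discrete (fun w => \sum_(i <- s) f i w)%N.
Proof.
move=> df; elim: s => [|i s IH].
  by under eq_fun do rewrite big_nil; exact: discrete_cst.
under eq_fun do rewrite big_cons.
exact: (@discrete_comp _ _ _ (fun p => p.1 + p.2)%N (discrete_pair (df i) IH)).
Qed.

Lemma discrete_measurable (C : countType) d' (D : measurableType d') (Z : T -> C) (f : C -> D) :
  discrete Z -> measurable_fun setT (f \o Z).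
Proof.
by move=> dZ _ Y _; rewrite setTI; apply: (@discrete_preimage _ Z (f @^-1` Y)).
Qed.

Context {R : realType} (P : probability T R).

Lemma discrete_RV (Y : {RV P >-> nat}) : discrete (Y : T -> nat).
Proof. by move=> z; rewrite -[_ @^-1` _]setTI; exact: measurable_funPT. Qed.

Lemma measurable_discrete_fun (C : countType) (Z : T -> C) (F : C -> R) : discrete Z ->
  measurable_fun setT (fun w => (F (Z w))%:E).
Proof. by move=> dZ; exact: (discrete_measurable (fun z => (F z)%:E) dZ). Qed.

(** A comparison of integrals over the fibers of two discrete variables, which
    may differ: typically [W n.+1] on one side and [W 1] on the other, so that
    independence and equality of laws are used fiber by fiber. *)
Lemma integral_fibers_le (C : countType) (Z Z' : T -> C) (A B : set T)
    (f h : T -> \bar R) (l : R) :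
  discrete Z -> discrete Z' -> measurable A -> measurable B ->
  measurable_fun setT f -> measurable_fun setT h -> 0 <= l ->
  (forall w, 0 <= f w)%E -> (forall w, 0 <= h w)%E ->
  (forall z, \int[P]_(w in A `&` Z @^-1` [set z]) f w
     <= l%:E * \int[P]_(w in B `&` Z' @^-1` [set z]) h w)%E ->
  (\int[P]_(w in A) f w <= l%:E * \int[P]_(w in B) h w)%E.
Proof.
move=> dZ dZ' mA mB mf mh l0 f0 h0 le_fib.
(* The fibers indexed by nat; a number that codes no value gives the empty set. *)
pose F (Y : T -> C) (D : set T) (i : nat) : set T :=
  if unpickle i is Some z then
    if pickle z == i then D `&` Y @^-1` [set z] else set0 else set0.
have cover Y D : D = \bigcup_i F Y D i.
  apply/seteqP; split=> w.
    by move=> Dw; exists (pickle (Y w)) => //; rewrite /F pickleK eqxx.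
  by move=> [i _]; rewrite /F; case: unpickle => // z; case: ifP => // _ [].
have meas Y D i : discrete Y -> measurable D -> measurable (F Y D i).
  move=> dY mD; rewrite /F; case: unpickle => // z; case: ifP => // _.
  exact: measurableI.
have triv Y D : trivIset setT (F Y D).
  apply/trivIsetP => i j _ _ ij; rewrite /F.
  case: unpickle => [z|]; last by rewrite set0I.
  case: eqP => [iE|]; last by rewrite set0I.
  case: (unpickle j) => [z'|]; last by rewrite setI0.
  case: eqP => [jE|]; last by rewrite setI0.
  apply/seteqP; split=> // w [[_ /= zE] [_ /= zz']].
  by move: ij; rewrite -iE -jE -zE zz' eqxx.
rewrite [A in leLHS](cover Z A) [B in leRHS](cover Z' B) !ge0_integral_bigcup //;
  [|by move=> i; exact: meas|exact: measurable_funTS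
   |by move=> i; exact: meas|exact: measurable_funTS].
rewrite -nneseriesZl; last by move=> i _; apply: integral_ge0.
apply: lee_nneseries => [i _ _|i _]; first exact: integral_ge0.
rewrite /F; case: unpickle => [z|]; last by rewrite !integral_set0 mule0.
by case: ifP => // _; rewrite !integral_set0 mule0.
Qed.

Lemma prob_fibers_eq (C : countType) (Z Z' : T -> C) (A B : set T) (l : R) :
  discrete Z -> discrete Z' -> measurable A -> measurable B -> 0 <= l ->
  (forall z, P (A `&` Z @^-1` [set z]) = l%:E * P (B `&` Z' @^-1` [set z]))%E ->
  (P A = l%:E * P B)%E.
Proof.
move=> dZ dZ' mA mB l0 eq_fib.
have intP D : measurable D -> (\int[P]_(w in D) 1 = P D)%E.
  by move=> mD; rewrite integral_cst // mul1e.
have [l_eq|lp] := eqVneq l 0.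
  rewrite l_eq mul0e; apply/eqP; rewrite eq_le measure_ge0 andbT.
  rewrite -intP // -[leRHS](mul0e (\int[P]_(w in B) 1)%E).
  apply: (integral_fibers_le dZ dZ') => // z.
  rewrite -l_eq !intP ?eq_fib //; exact: measurableI.
apply/eqP; rewrite eq_le -!intP //; apply/andP; split.
  apply: (integral_fibers_le dZ dZ') => // z.
  rewrite !intP ?eq_fib //; exact: measurableI.
have lgt : 0 < l by rewrite lt0r lp.
rewrite -lee_pdivlMl //; apply: (integral_fibers_le dZ' dZ) => //.
  by rewrite invr_ge0.
move=> z; rewrite !intP ?eq_fib //; [|exact: measurableI..].
by rewrite muleA -EFinM mulVf // mul1e.
Qed.

End Discrete.

(** * The law of one step of the graph process *)

Section GraphExtension.

(** Makes the next graph an explicit function of what is conditioned upon, hence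
    constant on the cells in [past_independence] and [step_integral_fiber]. *)
Definition ext_graph n c (g : 'M[nat]_n.+1) (x : 'I_c -> nat) : 'M[nat]_n.+2 :=
  (\matrix_(i < n.+2, j < n.+2)
    ((if (i < n.+1) && (j < n.+1) then g (inord i) (inord j) else 0)
     + \sum_(e < c) (((n.+1 == i) && (x e == j)) || ((n.+1 == j) && (x e == i)))))%N.

Lemma degree_ext_graph n c (g : 'M[nat]_n.+1) (x : {ffun 'I_c -> 'I_n.+1}) i :
  degree (ext_graph g (fun e => x e)) i = next_degree (degree g) x i.
Proof.
have xlt e : (x e < n.+1)%N by exact: ltn_ord.
rewrite /degree big_ord_recr /= mxE ltnn andbF add0n.
under eq_bigr => j _ do rewrite mxE /= ltn_ord andbT.
have [j ->|->] := unliftP ord_max i.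
  have E : nat_of_ord (lift ord_max j) = j by rewrite /= /bump leqNgt ltn_ord.
  rewrite /next_degree liftK E; congr (_ + _)%N.
    apply: eq_bigr => k _; rewrite ltn_ord /= !inord_val big1 ?addn0 // => e _.
    by rewrite gtn_eqF // (gtn_eqF (ltn_ord k)).
  by apply: eq_bigr => e _; rewrite gtn_eqF // eqxx.
rewrite next_degree_max /= ltnn eqxx /=.
rewrite [X in (_ + X)%N]big1 ?addn0 => [|e _]; last first.
  by rewrite ltn_eqF.
under eq_bigr => j _ do rewrite add0n.
under eq_bigr => j _.
  under eq_bigr => e _ do rewrite (gtn_eqF (ltn_ord j)) /= orbF.
  over.
exact: sum_load.
Qed.

Context {T : Type} (W : nat -> T -> nat) (X : nat -> nat -> T -> nat).
Hypothesis endpoint : forall s e w, (0 < s)%N -> (e < W s w)%N -> (X s e w < s)%N.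

Lemma pa_graphS n c w : W n.+1 w = c ->
  pa_graph W X n.+1 w = ext_graph (pa_graph W X n w) (fun e : 'I_c => X n.+1 e w).
Proof.
move=> <-; apply/matrixP => i j; rewrite !mxE big_nat_recr //=; congr (_ + _)%N.
case: ifP => [/andP[iln jln]|ij]; first by rewrite !inordK.
rewrite big_nat big1 // => s /andP[s0 sn]; rewrite big1 // => e _.
have xs := endpoint s0 (ltn_ord e).
suff no (a b : 'I_n.+2) : ~~ ((a < n.+1)%N && (b < n.+1)%N) ->
    ((s == a) && (X s e w == b)) = false.
  by rewrite !no // ?ij // andbC ij.
rewrite negb_and -!leqNgt => /orP[h|h].
  by rewrite ltn_eqF // (leq_trans sn).
by rewrite [X in _ && X]ltn_eqF ?andbF // (leq_trans xs) // (leq_trans _ h) // ltnW.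
Qed.

(** The endpoints of the first edges are forced, so the first graph depends on
    [W 1] alone; this starts the induction of [past_independence]. *)
Lemma pa_graph1 w w' : W 1%N w = W 1%N w' ->
  pa_graph W X 1 w = pa_graph W X 1 w'.
Proof.
move=> E; rewrite (pa_graphS E) (pa_graphS (erefl (W 1%N w'))); congr (ext_graph _ _).
  by apply/matrixP => i j; rewrite !mxE !big_geq.
apply/funext => e; have := @endpoint 1 e w isT; have := @endpoint 1 e w' isT.
by rewrite E => /(_ (ltn_ord e)) + /(_ (ltn_ord e)); rewrite !ltnS !leqn0 => /eqP -> /eqP ->.
Qed.

End GraphExtension.

Section Process.
Context {d : measure_display} {T : measurableType d} {R : realType}.
Context (P : probability T R) (delta : R).
Context (W : nat -> {RV P >-> nat}) (X : nat -> nat -> {RV P >-> nat}).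
Hypothesis hG : PARID delta W X.

Let endpoint := parid_endpoint hG.

Lemma discrete_pa_graph n : discrete (fun w => pa_graph W X n w).
Proof.
apply: discrete_matrix => i j; apply: discrete_sum => s.
apply: (@discrete_glue _ _ nat nat (W s)
   (fun c w => \sum_(e < c) (((s == i) && (X s e w == j)) || ((s == j) && (X s e w == i))))%N).
  exact: discrete_RV.
move=> c; apply: discrete_sum => e.
exact: (@discrete_comp _ _ nat nat (X s e)
  (fun x => nat_of_bool (((s == i) && (x == j)) || ((s == j) && (x == i)))) (discrete_RV _)).
Qed.

Definition initial_degrees N (c : nat -> nat) : set T :=
  [set w | forall i, (1 <= i <= N)%N -> W i w = c i].

Definition past n N (g : 'M[nat]_n.+1) (c : nat -> nat) : set T :=
  [set w | pa_graph W X n w = g /\ forall i, (1 <= i <= N)%N -> W i w = c i].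

Definition endpoints n k (x : 'I_k -> 'I_n.+1) : set T :=
  [set w | forall e : 'I_k, X n.+1 e w = x e].

Lemma initial_degreesE N c : initial_degrees N c =
  [set w | forall i, i \in iota 1 N -> [set c i] (W i w)].
Proof.
by apply/seteqP; split=> w h i; move: (h i); rewrite mem_iota add1n ltnS.
Qed.

Lemma measurable_initial_degrees N c : measurable (initial_degrees N c).
Proof.
have -> : initial_degrees N c = [set w | forall i : 'I_N, (W i.+1 @^-1` [set c i.+1]) w].
  apply/seteqP; split=> w h; first by move=> i; apply: h; rewrite /= ltn_ord.
  by case=> // i iN; apply: (h (Ordinal iN)).
by apply: measurable_forall_fin => i; exact: discrete_RV.
Qed.

Lemma measurable_past n N (g : 'M[nat]_n.+1) c : measurable (past N g c).
Proof.
have -> : past N g c = (fun w => pa_graph W X n w) @^-1` [set g] `&` initial_degrees N c.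
  by [].
by apply: measurableI; [exact: discrete_pa_graph|exact: measurable_initial_degrees].
Qed.

Lemma measurable_endpoints n k (x : 'I_k -> 'I_n.+1) : measurable (endpoints x).
Proof. by apply: measurable_forall_fin => e; exact: discrete_RV. Qed.

Notation r k := (prob_mass (W 1%N) k).

Lemma prob_W i k : (0 < i)%N -> P (W i @^-1` [set k]) = (r k)%:E.
Proof.
move=> i0; have := (parid_iid hG).1 i i0 [set k].
rewrite /distribution /pushforward => ->; rewrite fineK // fin_num_measure //.
exact: discrete_RV.
Qed.

Lemma prob_mass_ge0 k : 0 <= r k.
Proof. by rewrite /prob_mass fine_ge0. Qed.

Lemma prob_initial_degrees N c :
  P (initial_degrees N c) = (\prod_(i <- iota 1 N) (r (c i))%:E)%E.
Proof.
have := (parid_iid hG).2 (iota 1 N) (fun i => [set c i]) (iota_uniq 1 N).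
rewrite initial_degreesE => ->; last by move=> i; rewrite mem_iota => /andP[].
rewrite big_seq [RHS]big_seq; apply: eq_bigr => i; rewrite mem_iota => /andP[i1 _].
exact: prob_W.
Qed.

Lemma prob_initial_degreesS N c :
  P (initial_degrees N.+1 c) = ((r (c N.+1))%:E * P (initial_degrees N c))%E.
Proof.
rewrite !prob_initial_degrees -[N.+1]addn1 iotaD big_cat /= big_seq1 add1n addn1.
by rewrite muleC.
Qed.

(** The conditional law of the record [PARID] as an identity that also holds when
    the conditioning event is null.  The number of edges is a variable k equal to
    [c n.+1], which avoids dependent types in applications. *)
Lemma prob_endpoints n N c k (g : 'M[nat]_n.+1) (x : 'I_k -> 'I_n.+1) :
  (0 < n)%N -> (n < N)%N -> c n.+1 = k ->
  P (past N g c `&` endpoints x) =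
  ((\prod_(e < k) attach_prob delta g (x e))%:E * P (past N g c))%E.
Proof.
move=> n0 nN ck; case: k / ck x => x.
have [P0|Pn0] := eqVneq (P (past N g c)) 0%E.
  rewrite P0 mule0; apply: subset_measure0 P0; last exact: subIsetl.
  - by apply: measurableI; [exact: measurable_past|exact: measurable_endpoints].
  - exact: measurable_past.
have Ppos : (0 < P (past N g c))%E by rewrite lt0e Pn0 measure_ge0.
have fin A : measurable A -> (fine (P A))%:E = P A.
  by move=> mA; rewrite fineK // fin_num_measure.
have pastE := fin _ (measurable_past N g c).
have := parid_step hG x n0 nN Ppos; rewrite /cond_prob => <-.
rewrite -[X in (_ * X)%E]pastE -EFinM divfK; last first.
  by apply: contra Pn0 => /eqP h; rewrite -pastE; apply/eqP; congr EFin.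
rewrite fin; first by rewrite setIC.
by apply: measurableI; [exact: measurable_endpoints|exact: measurable_past].
Qed.

(** The graph at time n is independent of the later initial degrees.  By induction
    on n: given the graph at time n and the endpoints, the next graph is
    determined, and the conditional law of the endpoints does not depend on how
    many initial degrees are revealed. *)
Lemma past_independence n N (g : 'M[nat]_n.+1) c : (0 < n)%N -> (n <= N)%N ->
  P (past N.+1 g c) = ((r (c N.+1))%:E * P (past N g c))%E.
Proof.
elim: n N g => [//|[_|n IH]] N g _ nN.
  have [[w0 [w0E w0g]]|no] := pselect (exists w, W 1%N w = c 1%N /\ pa_graph W X 1 w = g).
    have E M : (0 < M)%N -> past M g c = initial_degrees M c.
      move=> M0; apply/seteqP; split=> w; first by case.
      move=> h; split=> //; rewrite -w0g; apply: pa_graph1 => //.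
      by rewrite w0E h.
    by rewrite !E // prob_initial_degreesS.
  have E M : (0 < M)%N -> past M g c = set0.
    move=> M0; apply/seteqP; split=> w // [gw h]; apply: no; exists w.
    by rewrite h.
  by rewrite !E // !measure0 mule0.
(* Both sides are compared given the previous graph and the new endpoints. *)
pose Z w := (pa_graph W X n.+1 w, [ffun e : 'I_(c n.+2) => (inord (X n.+2 e w) : 'I_n.+2)]).
have dZ : discrete Z.
  apply: discrete_pair; first exact: discrete_pa_graph.
  apply: discrete_ffun => e.
  exact: (@discrete_comp _ _ nat _ _ (fun k => inord k : 'I_n.+2) (discrete_RV (X n.+2 e))).
apply: (prob_fibers_eq dZ dZ); [exact: measurable_past|exact: measurable_past|exact: prob_mass_ge0|].
move=> [g' x].
have cell M : (n.+2 <= M)%N -> past M g c `&` Z @^-1` [set (g', x)] =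
    if ext_graph g' (fun e => x e) == g then past M g' c `&` endpoints x else set0.
  move=> nM.
  have key w : (forall i, (1 <= i <= M)%N -> W i w = c i) ->
      Z w = (g', x) <-> pa_graph W X n.+1 w = g' /\ endpoints x w.
    move=> h; have hW : W n.+2 w = c n.+2 by apply: h; rewrite /= nM.
    have xlt (e : 'I_(c n.+2)) : (X n.+2 e w < n.+2)%N.
      by apply: endpoint => //; rewrite hW.
    split=> [[-> <-]|[gw xw]]; first by split=> // e; rewrite ffunE inordK.
    rewrite /Z gw; congr pair; apply/ffunP => e; rewrite ffunE.
    by apply: val_inj; rewrite /= xw inord_val.
  have ext w : (forall i, (1 <= i <= M)%N -> W i w = c i) ->
      pa_graph W X n.+1 w = g' -> endpoints x w ->
      pa_graph W X n.+2 w = ext_graph g' (fun e => x e).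
    move=> h gw xw; have hW : W n.+2 w = c n.+2 by apply: h; rewrite /= nM.
    rewrite (pa_graphS endpoint hW) gw; congr ext_graph; apply/funext => e; exact: xw.
  case: ifPn => [/eqP gE|gN]; apply/seteqP; split=> w //=.
  - by move=> [[gw h] /(key w h) [g'w xw]].
  - by move=> [[gw h] xw]; split; [split=> //; rewrite (ext w)|apply/key].
  - by move=> [[gw h] /(key w h) [g'w xw]]; move: gN; rewrite -gw (ext w) ?eqxx.
rewrite !cell 1?(leqW nN) //; case: ifP => _; last by rewrite !measure0 mule0.
have nN' : (n.+1 < N.+1)%N by exact: ltnW.
rewrite (@prob_endpoints n.+1 _ c) // (@prob_endpoints n.+1 _ c) //.
by rewrite IH ?(ltnW nN) // muleCA.
Qed.

(** The default value of [inord] is never used for the edges that exist. *)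
Definition choices n c w : {ffun 'I_c -> 'I_n.+1} := [ffun e : 'I_c => inord (X n.+1 e w)].

Lemma degree_pa_graphS n c w i : W n.+1 w = c ->
  degree (pa_graph W X n.+1 w) i = next_degree (degree (pa_graph W X n w)) (choices n c w) i.
Proof.
move=> Wc; rewrite -degree_ext_graph (pa_graphS endpoint Wc); congr (degree (ext_graph _ _) i).
by apply/funext => e; rewrite ffunE inordK //; apply: endpoint; rewrite // Wc.
Qed.

Lemma degree_pa_graph_ge m n w : (0 < n)%N ->
  (forall i, (0 < i <= n)%N -> (m <= W i w)%N) ->
  forall i, (m <= degree (pa_graph W X n w) i)%N.
Proof.
elim: n => // n IH _ h i; rewrite (degree_pa_graphS _ (erefl (W n.+1 w))) /next_degree.
have hn : (m <= W n.+1 w)%N by apply: h; rewrite /= leqnn.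
case: unliftP => [j _|_] //; case: n => [|n] in IH h i hn j *; last first.
  by rewrite (leq_trans _ (leq_addr _ _)) // IH // => k /andP[k0 kn]; apply: h; rewrite k0 leqW.
apply: leq_trans (leq_addl _ _); apply: leq_trans hn _.
by rewrite -{1}(sum_load (choices 0 (W 1%N w) w)) big_ord1 (ord1 j).
Qed.

Lemma sum_degree_pa_graph n w :
  (\sum_i degree (pa_graph W X n w) i = 2 * \sum_(1 <= s < n.+1) W s w)%N.
Proof.
elim: n => [|n IH].
  by rewrite big_ord1 /degree big_ord1 mxE !big_geq.
rewrite big_ord_recr big_nat_recr //= mulnDr -IH.
rewrite (degree_pa_graphS _ (erefl (W n.+1 w))) next_degree_max.
under eq_bigr do rewrite (degree_pa_graphS _ (erefl (W n.+1 w))) next_degree_widen.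
by rewrite big_split /= sum_load mul2n -addnn addnA.
Qed.

(** Almost surely no initial degree is below m, and then no degree is. *)
Lemma prob_min_degree m n (g : 'M[nat]_n.+1) : (0 < n)%N ->
  (forall k, (k < m)%N -> r k = 0) ->
  P ((fun w => pa_graph W X n w) @^-1` [set g]) != 0%E -> forall i, (m <= degree g i)%N.
Proof.
move=> n0 rm Pg i; rewrite leqNgt; apply: contra Pg => small.
apply/eqP/negligibleP; first exact: discrete_pa_graph.
pose F j k : set T := if (k < m)%N then W j.+1 @^-1` [set k] else set0.
apply: (negligibleS (A := \bigcup_j \bigcup_k F j k)).
  move=> w gw; apply: contrapT => no; move: small; rewrite ltnNge -gw => /negP; apply.
  apply: degree_pa_graph_ge => // -[|j] // _; rewrite leqNgt; apply/negP => Wm.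
  by apply: no; exists j => //; exists (W j.+1 w) => //; rewrite /F Wm.
apply: negligible_bigcup => j; apply: negligible_bigcup => k; rewrite /F.
case: ifP => km; last exact: negligible_set0.
apply/negligibleP; first exact: discrete_RV.
by have := prob_W k (ltn0Sn j); rewrite rm.
Qed.

(** Obtained by summing [prob_endpoints] and [past_independence] over the values
    of the first n initial degrees. *)
Lemma step_law n (g : 'M[nat]_n.+1) k (x : 'I_k -> 'I_n.+1) : (0 < n)%N ->
  (forall i, 0 <= attach_prob delta g i) ->
  P ((fun w => pa_graph W X n w) @^-1` [set g] `&` W n.+1 @^-1` [set k] `&` endpoints x) =
  ((\prod_(e < k) attach_prob delta g (x e) * r k)%:E
    * P ((fun w => pa_graph W X n w) @^-1` [set g]))%E.
Proof.
move=> n0 attach0; pose Z w := [ffun i : 'I_n => W i.+1 w].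
have dZ : discrete Z by apply: discrete_ffun => i; exact: discrete_RV.
have mg := @discrete_pa_graph n g; have mk := @discrete_RV _ _ _ _ (W n.+1) k.
have mx := measurable_endpoints x.
rewrite EFinM; apply: (prob_fibers_eq dZ dZ) => //.
- by apply: measurableI => //; apply: measurableI.
- by apply: mulr_ge0 (prob_mass_ge0 k); apply: prodr_ge0.
move=> z; pose c i := if i == n.+1 then k else oapp z 0%N (insub i.-1).
have ck : c n.+1 = k by rewrite /c eqxx.
have cz (i : 'I_n) : c i.+1 = z i.
  by rewrite /c eqSS ltn_eqF //= insubT //= => h; congr (z _); apply: val_inj.
have cellB : (fun w => pa_graph W X n w) @^-1` [set g] `&` Z @^-1` [set z] = past n g c.
  apply/seteqP; split=> w /=.
    move=> [gw zw]; split=> // -[//|i] /= iN.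
    by rewrite (cz (Ordinal iN)) -zw ffunE.
  move=> [gw h]; split=> //; apply/ffunP => i; rewrite ffunE -cz; apply: h.
  by rewrite /= ltn_ord.
have cellA : (fun w => pa_graph W X n w) @^-1` [set g] `&` W n.+1 @^-1` [set k] `&` endpoints x
    `&` Z @^-1` [set z] = past n.+1 g c `&` endpoints x.
  rewrite setIAC; congr (_ `&` _); rewrite setIAC cellB; apply/seteqP; split=> w /=.
    move=> [[gw h] wk]; split=> // i /andP[i1]; rewrite leq_eqVlt => /orP[/eqP ->|iN].
      by rewrite wk ck.
    by apply: h; rewrite i1.
  move=> [gw h]; split; last by rewrite -ck; apply: h; rewrite /= leqnn.
  by split=> // i /andP[i1 iN]; apply: h; rewrite i1 leqW.
rewrite cellA cellB (@prob_endpoints n n.+1 c k g x) // past_independence // ck.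
by rewrite muleA EFinM.
Qed.

(** The conditional mean of F at time n+1 given the graph g at time n and k new
    edges. *)
Definition step_average n (F : 'M[nat]_n.+2 -> R) (g : 'M[nat]_n.+1) k : R :=
  \sum_(x : {ffun 'I_k -> 'I_n.+1})
     choice_weight (attach_weight delta (degree g)) x * F (ext_graph g (fun e => x e)).

Lemma step_integral_fiber n (F : 'M[nat]_n.+2 -> R) (g : 'M[nat]_n.+1) k : (0 < n)%N ->
  (forall i, 0 <= attach_prob delta g i) -> (forall g', 0 <= F g') ->
  (\int[P]_(w in ((fun w => pa_graph W X n w) @^-1` [set g]) `&` W n.+1 @^-1` [set k])
      (F (pa_graph W X n.+1 w))%:E
   <= (step_average F g k * r k)%:E * P ((fun w => pa_graph W X n w) @^-1` [set g]))%E.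
Proof.
move=> n0 a0 F0; set G := _ @^-1` [set g]; set D := G `&` _.
have mG : measurable G by exact: discrete_pa_graph.
have mD : measurable D by apply: measurableI => //; exact: discrete_RV.
pose f (x : {ffun 'I_k -> 'I_n.+1}) (w : T) : \bar R :=
  ((F (ext_graph g (fun e => x e)))%:E * (\1_(endpoints x) w)%:E)%E.
have mf x : measurable_fun D (f x).
  apply: measurable_funTS; apply: measurable_funeM.
  by apply/measurable_EFinP; apply: measurable_indic; exact: measurable_endpoints.
have f0 x w : D w -> (0 <= f x w)%E by move=> _; rewrite mule_ge0 // lee_fin.
apply: (@le_trans _ _ (\int[P]_(w in D) \sum_x f x w)%E).
  apply: ge0_le_integral => //.
  - by move=> w _; rewrite lee_fin.
  - by apply: measurable_funTS; apply: measurable_discrete_fun; exact: discrete_pa_graph.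
  - exact: emeasurable_sum.
  move=> w [gw Wk]; rewrite (bigD1 (choices n k w)) //=.
  apply: (@le_trans _ _ (f (choices n k w) w)); last first.
    by rewrite leeDl // sume_ge0 // => x _; apply: f0.
  have xw (e : 'I_k) : X n.+1 e w = choices n k w e.
    by rewrite ffunE inordK //; apply: endpoint; rewrite // Wk.
  rewrite /f indicE mem_set ?mule1 // (pa_graphS endpoint Wk) gw lee_fin.
  by rewrite (_ : (fun e : 'I_k => X n.+1 e w) = fun e => choices n k w e) //; apply/funext.
rewrite ge0_integral_sum //.
have intf x : (\int[P]_(w in D) f x w = (F (ext_graph g (fun e => x e)) *
    (choice_weight (attach_weight delta (degree g)) x * r k))%:E * P G)%E.
  rewrite /f ge0_integralZl_EFin //; last first.
    apply: measurable_funTS; apply/measurable_EFinP; apply: measurable_indic; exact: measurable_endpoints.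
  rewrite integral_indic //; last exact: measurable_endpoints.
  by rewrite setIC EFinM -muleA; congr (_ * _)%E; exact: (step_law x n0 a0).
under eq_bigr do rewrite intf.
rewrite -ge0_sume_distrl; last first.
  move=> x _; rewrite lee_fin mulr_ge0 // mulr_ge0 ?prob_mass_ge0 //; apply: prodr_ge0 => e _; exact: a0.
rewrite sumEFin; apply: lee_wpmul2r => //; rewrite lee_fin /step_average mulr_suml.
by apply: ler_sum => x _; rewrite mulrCA mulrA.
Qed.

Lemma step_integral n (F : 'M[nat]_n.+2 -> R) (g : 'M[nat]_n.+1) : (0 < n)%N ->
  (forall i, 0 <= attach_prob delta g i) -> (forall g', 0 <= F g') ->
  (\int[P]_(w in (fun w => pa_graph W X n w) @^-1` [set g]) (F (pa_graph W X n.+1 w))%:E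
   <= P ((fun w => pa_graph W X n w) @^-1` [set g]) *
      \int[P]_w (step_average F g (W 1%N w))%:E)%E.
Proof.
move=> n0 a0 F0; set G := _ @^-1` [set g].
have mG : measurable G by exact: discrete_pa_graph.
have PG : (fine (P G))%:E = P G by rewrite fineK // fin_num_measure.
have avg0 k : 0 <= step_average F g k.
  apply: sumr_ge0 => x _; rewrite mulr_ge0 //; apply: prodr_ge0 => e _; exact: a0.
rewrite -PG; apply: (integral_fibers_le (discrete_RV (W n.+1)) (discrete_RV (W 1%N))) => //.
- by apply: measurable_discrete_fun; exact: discrete_pa_graph.
- by apply: measurable_discrete_fun; exact: discrete_RV.
- by rewrite fine_ge0.
- by move=> w; rewrite lee_fin.
- by move=> w; rewrite lee_fin.
move=> k; apply: le_trans (step_integral_fiber k n0 a0 F0) _.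
rewrite -/G -PG muleC; apply: lee_wpmul2l; first by rewrite lee_fin fine_ge0.
rewrite setTI (eq_integral (cst (step_average F g k)%:E)); last first.
  by move=> w; rewrite inE /= => ->.
rewrite integral_cst; last exact: discrete_RV.
by rewrite EFinM -(prob_W k (isT : (0 < 1)%N)).
Qed.

(** The tool for both recursions below: a bound on the conditional expectation for
    every graph g of positive probability is integrated over g. *)
Lemma step_expectation n (F : 'M[nat]_n.+2 -> R) (U : 'M[nat]_n.+1 -> R) : (0 < n)%N ->
  (forall g, 0 <= F g) -> (forall g, 0 <= U g) ->
  (forall g, P ((fun w => pa_graph W X n w) @^-1` [set g]) != 0%E ->
     (forall i, 0 <= attach_prob delta g i) /\
     (\int[P]_w (step_average F g (W 1%N w))%:E <= (U g)%:E)%E) ->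
  (\int[P]_w (F (pa_graph W X n.+1 w))%:E <= \int[P]_w (U (pa_graph W X n w))%:E)%E.
Proof.
move=> n0 F0 U0 h; have dG := @discrete_pa_graph n.
rewrite -[leRHS]mul1e; apply: (integral_fibers_le dG dG) => //.
- by apply: measurable_discrete_fun; exact: discrete_pa_graph.
- by apply: measurable_discrete_fun; exact: discrete_pa_graph.
- by move=> w; rewrite lee_fin.
- by move=> w; rewrite lee_fin.
move=> g; rewrite mul1e !setTI.
rewrite [leRHS](eq_integral (cst (U g)%:E)); last first.
  by move=> w; rewrite inE /= => ->.
rewrite integral_cst //; have [P0|Pn0] := eqVneq (P ((fun w => pa_graph W X n w) @^-1` [set g])) 0%E.
  rewrite null_set_integral ?mule_ge0 ?lee_fin //.
  by apply: measurable_funTS; apply: measurable_discrete_fun; exact: discrete_pa_graph.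
have [a0 le_U] := h g Pn0; apply: le_trans (step_integral n0 a0 F0) _.
by rewrite muleC lee_wpmul2r.
Qed.

End Process.

(** * Averages over the initial degree *)

Section Averages.
Context {d : measure_display} {T : measurableType d} {R : realType}.
Context (P : probability T R) (Y : {RV P >-> nat}).
Hypothesis Y_int : P.-integrable setT (fun w => (Y w)%:R%:E : \bar R).

Definition mean (f : nat -> R) : R := fine (\int[P]_w (f (Y w))%:E).

Lemma integrable_affine_bound (f : nat -> R) (a b : R) :
  (forall c, `|f c| <= a + b * c%:R) -> P.-integrable setT (fun w => (f (Y w))%:E).
Proof.
move=> h; apply: (@le_integrable _ _ _ P _ _ _ (fun w => (a + b * (Y w)%:R)%:E)) => //.
- by apply: measurable_discrete_fun; exact: discrete_RV.
- by move=> w _; rewrite /= lee_fin (le_trans (h _)) ?ler_norm.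
rewrite (_ : (fun w => _) = (fun w => a%:E + b%:E * (Y w)%:R%:E)%E) //.
apply: integrableD => //; last exact: integrableZl.
exact: finite_measure_integrable_cst.
Qed.

Lemma meanE (f : nat -> R) (a b : R) : (forall c, `|f c| <= a + b * c%:R) ->
  (\int[P]_w (f (Y w))%:E = (mean f)%:E)%E.
Proof.
by move=> /integrable_affine_bound h; rewrite /mean fineK //; apply: integrable_fin_num.
Qed.

Lemma mean_indicator k : mean (fun c => (c == k)%:R) = prob_mass Y k.
Proof.
rewrite /mean /prob_mass; congr fine.
have -> : P (Y @^-1` [set k]) = (\int[P]_w (\1_(Y @^-1` [set k]) w)%:E)%E.
  by rewrite integral_indic ?setIT //; exact: discrete_RV.
apply: eq_integral => w _; rewrite indicE.
by case: eqP => Yk; [rewrite mem_set|rewrite memNset].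
Qed.

(** The shape of the one-step bounds: a function of c that is affine up to point
    masses and a cost B c.  Point masses are kept apart because their means
    [prob_mass Y k] must cancel against the stationarity equation. *)
Lemma mean_le_affine (h B : nat -> R) (v : nat -> R) (alpha gamma a b : R) K :
  (forall w, (0 < Y w)%N) -> (forall c, 0 <= h c) ->
  (forall c, `|B c| <= a + b * c%:R) ->
  (forall c, (0 < c)%N -> h c <= alpha * c%:R + \sum_(k < K) v k * (c == k)%:R + gamma + B c) ->
  (\int[P]_w (h (Y w))%:E <=
   (alpha * mean (fun c => c%:R) + \sum_(k < K) v k * prob_mass Y k + gamma + mean B)%:E)%E.
Proof.
move=> Y0 h0 Bb hle; have mY f := measurable_discrete_fun (R := R) f (discrete_RV Y).
apply: (@le_trans _ _ (\int[P]_w (alpha%:E * (Y w)%:R%:E +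
   \sum_(k < K) ((v k)%:E * (Y w == k)%:R%:E) + gamma%:E + (B (Y w))%:E))%E).
  have E w : (alpha%:E * (Y w)%:R%:E +
     \sum_(k < K) ((v k)%:E * (Y w == k)%:R%:E) + gamma%:E + (B (Y w))%:E)%E =
     (alpha * (Y w)%:R + \sum_(k < K) v k * (Y w == k)%:R + gamma + B (Y w))%:E.
    by rewrite !EFinD EFinM -sumEFin.
  under [leRHS]eq_integral do rewrite E.
  apply: ge0_le_integral => //.
  - by move=> w _; rewrite lee_fin.
  - exact: (mY (fun c => alpha * c%:R + \sum_(k < K) v k * (c == k)%:R + gamma + B c)).
  - by move=> w _; rewrite lee_fin hle.
have iY : P.-integrable setT (fun w => alpha%:E * (Y w)%:R%:E)%E by exact: integrableZl.
have i1 k : P.-integrable setT (fun w => (v k)%:E * (Y w == k)%:R%:E)%E.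
  apply: integrableZl => //; apply: (@integrable_affine_bound (fun c => (c == k)%:R) 1 0) => c.
  by rewrite mul0r addr0 normr_nat lern1 leq_b1.
have iS : P.-integrable setT (fun w => \sum_(k < K) ((v k)%:E * (Y w == k)%:R%:E))%E.
  exact: integrable_sum.
have iC : P.-integrable setT (fun=> gamma%:E) by exact: finite_measure_integrable_cst.
have iB := integrable_affine_bound Bb.
rewrite !integralD //; [|by apply: integrableD|by apply: integrableD => //; exact: integrableD].
rewrite integralZl // integral_sum //.
have -> : (\int[P]_(w in setT) gamma%:E = gamma%:E)%E.
  by rewrite integral_cst // [X in (_ * X)%E](probability_setT P) mule1.
rewrite (meanE Bb).
rewrite (@meanE (fun c => c%:R) 0 1); last by move=> c; rewrite add0r mul1r normr_nat.
rewrite !EFinD EFinM -sumEFin !leeD2r // leeD2l // le_eqVlt; apply/orP; left; apply/eqP.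
apply: eq_bigr => k _; rewrite integralZl //; last first.
  apply: (@integrable_affine_bound (fun c => (c == k)%:R) 1 0) => c.
  by rewrite mul0r addr0 normr_nat lern1 leq_b1.
rewrite (@meanE (fun c => (c == k)%:R) 1 0) ?mean_indicator // => c.
by rewrite mul0r addr0 normr_nat lern1 leq_b1.
Qed.

End Averages.

(** * Concentration of the number of edges and the second moment recursion *)

Section SmoothAbs.
Context {R : rcfType}.
Variable lam : R.
Hypothesis lam_gt0 : 0 < lam.

(** A smooth substitute for the absolute value: it is quadratic at scale lam, so
    centered increments cost only their truncated second moment, and it has
    linear growth, so a first moment suffices. *)
Definition smooth_abs (y : R) : R := Num.sqrt (lam ^+ 2 + y ^+ 2).

Definition increment_cost (u : R) : R := Num.min (u ^+ 2 / lam) (2 * `|u|).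

Lemma smooth_abs_sqr y : smooth_abs y ^+ 2 = lam ^+ 2 + y ^+ 2.
Proof. by rewrite sqr_sqrtr // addr_ge0 ?sqr_ge0. Qed.

Lemma smooth_abs_ge y : `|y| <= smooth_abs y.
Proof. by rewrite -sqrtr_sqr ler_sqrt ?lerDr ?sqr_ge0 // addr_ge0 ?sqr_ge0. Qed.

Lemma smooth_abs_ge_lam y : lam <= smooth_abs y.
Proof.
by rewrite -ler_sqr ?nnegrE ?sqrtr_ge0 ?(ltW lam_gt0) // smooth_abs_sqr lerDl sqr_ge0.
Qed.

Lemma smooth_abs0 : smooth_abs 0 = lam.
Proof. by rewrite /smooth_abs expr0n addr0 sqrtr_sqr ger0_norm ?ltW. Qed.

(** The quadratic bound is the inequality B <= (A^2 + B^2)/(2A) for the two values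
    A and B of [smooth_abs]; the linear one holds because [smooth_abs] is
    1-Lipschitz. *)
Lemma smooth_abs_add y u :
  smooth_abs (y + u) <= smooth_abs y + y / smooth_abs y * u + increment_cost u.
Proof.
have A2 := smooth_abs_sqr y; have B2 := smooth_abs_sqr (y + u).
have Al := smooth_abs_ge_lam y; have Ay := smooth_abs_ge y.
have Bl := smooth_abs_ge_lam (y + u).
move: (smooth_abs y) (smooth_abs (y + u)) A2 B2 Al Ay Bl => A B A2 B2 Al Ay Bl.
have A0 : 0 < A by exact: lt_le_trans Al.
have B0 : 0 < B by exact: lt_le_trans Bl.
rewrite /increment_cost -lerBlDl le_min; apply/andP; split.
  have h : B * (2 * A) <= 2 * A ^+ 2 + 2 * y * u + u ^+ 2.
    by have := sqr_ge0 (A - B); lra.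
  have e : A * (y / A * u) = y * u by field; rewrite gt_eqF.
  apply: (@le_trans _ _ (u ^+ 2 / (2 * A))).
    rewrite ler_pdivlMr; last by lra.
    have e2 : (y / A * u) * (2 * A) = 2 * (y * u) by rewrite -e; ring.
    by move: h e2; move: (y / A * u) => z h e2; lra.
  rewrite ler_wpM2l ?sqr_ge0 // lef_pV2 ?posrE //; lra.
have hB : B <= A + `|u|.
  rewrite -ler_sqr ?nnegrE ?addr_ge0 ?(ltW A0) ?(ltW B0) //.
  have : y * u <= A * `|u|.
    by rewrite (le_trans (ler_norm _)) // normrM ler_wpM2r.
  by have := real_normK (num_real u); lra.
have : - (y / A * u) <= `|u|.
  rewrite (le_trans (ler_norm _)) // normrN normrM ler_piMl //.
  by rewrite normf_div (ger0_norm (ltW A0)) ler_pdivrMr // mul1r.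
by lra.
Qed.

Lemma increment_cost_bound u : 0 <= increment_cost u <= 2 * `|u|.
Proof.
rewrite /increment_cost ge_min lexx orbT andbT le_min.
by rewrite divr_ge0 ?sqr_ge0 ?(ltW lam_gt0) // mulr_ge0.
Qed.

End SmoothAbs.

Section Recursion.
Context {d : measure_display} {T : measurableType d} {R : realType}.
Context (P : probability T R) (delta : R).
Context (W : nat -> {RV P >-> nat}) (X : nat -> nat -> {RV P >-> nat}).
Hypothesis hG : PARID delta W X.
Hypothesis W_int : P.-integrable setT (fun w => (W 1%N w)%:R%:E : \bar R).
Variable m : nat.
Hypothesis mass_small : forall k, (k < m)%N -> prob_mass (W 1%N) k = 0.
Hypothesis delta_m : 0 < delta + m%:R.

Let mu := mean (W 1%N) (fun c => c%:R).
Let kappa := delta + m%:R.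
Let G n w := pa_graph W X n w.

Let W_gt0 w : (0 < W 1%N w)%N. Proof. exact: (parid_pos hG). Qed.

(** The number of edges; half the total degree is a function of the graph alone. *)
Definition half_degree n (g : 'M[nat]_n.+1) : R := (\sum_i degree g i)%N%:R / 2.

Lemma half_degree_ext n c (g : 'M[nat]_n.+1) (x : {ffun 'I_c -> 'I_n.+1}) :
  half_degree (ext_graph g (fun e => x e)) = half_degree g + c%:R.
Proof.
rewrite /half_degree; under eq_bigr do rewrite degree_ext_graph.
rewrite big_ord_recr /= next_degree_max; under eq_bigr do rewrite next_degree_widen.
by rewrite big_split /= sum_load !natrD; field.
Qed.

Lemma total_weight n (g : 'M[nat]_n.+1) :
  \sum_i ((degree g i)%:R + delta) = 2 * half_degree g + n.+1%:R * delta.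
Proof.
by rewrite big_split /= sumr_const card_ord -mulr_natl /half_degree natr_sum; field.
Qed.

Section GoodGraph.
Variables (n : nat) (g : 'M[nat]_n.+1).
Hypothesis deg_ge : forall i, (m <= degree g i)%N.

Lemma good_degree i : kappa <= (degree g i)%:R + delta.
Proof. by rewrite /kappa addrC lerD2r ler_nat. Qed.

Lemma good_total : n.+1%:R * kappa <= \sum_i ((degree g i)%:R + delta).
Proof.
rewrite mulr_natl -[in leLHS](card_ord n.+1) -sumr_const.
by apply: ler_sum => i _; exact: good_degree.
Qed.

Lemma good_total_gt0 : 0 < \sum_i ((degree g i)%:R + delta).
Proof. by apply: lt_le_trans good_total; rewrite mulr_gt0. Qed.

Lemma good_attach_ge0 i : 0 <= attach_prob delta g i.
Proof.
by rewrite divr_ge0 ?(ltW good_total_gt0) // (le_trans _ (good_degree i)) // ltW.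
Qed.

Lemma good_attach_sum : \sum_i attach_weight delta (degree g) i = 1.
Proof. by rewrite /attach_weight -mulr_suml divff // gt_eqF // good_total_gt0. Qed.

End GoodGraph.

Lemma min_degree_of_prob_pos n (g : 'M[nat]_n.+1) : (0 < n)%N ->
  P ((fun w => pa_graph W X n w) @^-1` [set g]) != 0%E -> forall i, (m <= degree g i)%N.
Proof. by move=> n0; apply: (prob_min_degree hG) => //; exact: mass_small. Qed.

Definition expected_cost lam : R :=
  mean (W 1%N) (fun c => increment_cost lam (c%:R - mu)).

Lemma expected_cost_ge0 lam : 0 < lam -> 0 <= expected_cost lam.
Proof.
move=> l0; rewrite fine_ge0 // integral_ge0 // => w _.
by rewrite lee_fin; have /andP[] := increment_cost_bound l0 ((W 1%N w)%:R - mu).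
Qed.

Lemma integral_add_cst n (F : 'M[nat]_n.+1 -> R) k : (forall w, 0 <= F (G n w)) -> 0 <= k ->
  (\int[P]_w (F (G n w) + k)%:E = \int[P]_w (F (G n w))%:E + k%:E)%E.
Proof.
move=> F0 k0; under eq_integral do rewrite EFinD.
rewrite ge0_integralD //.
- congr (_ + _)%E; rewrite integral_cst // [X in (_ * X)%E](probability_setT P) mule1 //.
- by move=> w _; rewrite lee_fin.
- by apply: measurable_discrete_fun; exact: discrete_pa_graph.
Qed.

Lemma mean_smooth_abs_step lam y : 0 < lam ->
  (\int[P]_w (smooth_abs lam (y + ((W 1%N w)%:R - mu)))%:E
   <= (smooth_abs lam y + expected_cost lam)%:E)%E.
Proof.
move=> l0; pose al := y / smooth_abs lam y.
have := @mean_le_affine _ _ _ P (W 1%N) W_int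
  (fun c => smooth_abs lam (y + (c%:R - mu))) (fun c => increment_cost lam (c%:R - mu))
  (fun=> 0) al (smooth_abs lam y - al * mu) (2 * `|mu|) 2 0%N W_gt0 (fun=> sqrtr_ge0 _).
rewrite big_ord0 -/mu -/(expected_cost lam) => h; apply: le_trans (h _ _) _.
- move=> c; have /andP[b0 b1] := increment_cost_bound l0 (c%:R - mu).
  rewrite ger0_norm // (le_trans b1) // -mulrDr ler_pM2l // [leRHS]addrC.
  by rewrite (le_trans (ler_normB _ _)) // normr_nat.
- move=> c _; rewrite big_ord0; have := smooth_abs_add l0 y (c%:R - mu).
  by rewrite -/al; lra.
by rewrite lee_fin; lra.
Qed.

(** The increment W_(n+1) - mu is centered given the past, so the first order term
    of [smooth_abs_add] vanishes and each step costs [expected_cost lam]. *)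
Lemma edge_count_concentration lam n : 0 < lam -> (0 < n)%N ->
  (\int[P]_w (smooth_abs lam (half_degree (G n w) - n%:R * mu))%:E
   <= (lam + n%:R * expected_cost lam)%:E)%E.
Proof.
move=> l0; elim: n => // -[_ _|n IH _].
  have := mean_smooth_abs_step 0 l0; rewrite smooth_abs0 // !mul1r => h.
  apply: le_trans h; rewrite le_eqVlt; apply/orP; left; apply/eqP.
  apply: eq_integral => w _; rewrite add0r ?mul1r /half_degree (sum_degree_pa_graph hG).
  by rewrite big_nat1 natrM mulrC mulKf.
have {}IH := IH isT.
apply: (@le_trans _ _ (\int[P]_w (smooth_abs lam (half_degree (G n.+1 w) - n.+1%:R * mu)
   + expected_cost lam)%:E)%E).
  apply: (step_expectation hG (F := fun g => smooth_abs lam (half_degree g - n.+2%:R * mu))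
     (U := fun g => smooth_abs lam (half_degree g - n.+1%:R * mu) + expected_cost lam)) => //.
  - by move=> g; exact: sqrtr_ge0.
  - move=> g; by rewrite addr_ge0 ?sqrtr_ge0 ?expected_cost_ge0.
  move=> g Pg; have good := @min_degree_of_prob_pos n.+1 g isT Pg.
  split; first exact: good_attach_ge0.
  apply: le_trans (mean_smooth_abs_step _ l0); rewrite le_eqVlt; apply/orP; left; apply/eqP.
  apply: eq_integral => w _; congr EFin; rewrite /step_average.
  under eq_bigr do rewrite half_degree_ext.
  rewrite -mulr_suml sum_choice_weight ?mul1r; last exact: good_attach_sum.
  by congr smooth_abs; rewrite -[n.+2%:R]natr1; ring.
have := @integral_add_cst n.+1 (fun g => smooth_abs lam (half_degree g - n.+1%:R * mu))
  (expected_cost lam) (fun=> sqrtr_ge0 _) (expected_cost_ge0 l0).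
move=> ->.
apply: le_trans (leeD2r _ IH) _.
by rewrite -EFinD lee_fin -[n.+2%:R]natr1; lra.
Qed.

Section SquareDeviation.
Variables (theta Cp : R) (p : nat -> R).
Hypothesis theta_ge0 : 0 <= theta.
Hypothesis theta_mean : theta * mu = 2 * mu + delta.
Hypothesis law : limit_law delta theta Cp p (fun k => prob_mass (W 1%N) k).

Let C1 := step_constant theta Cp kappa.

Definition truncated_cost t : R := mean (W 1%N) (fun c => C1 * (c * minn c t)%N%:R).

Lemma step_constant_ge0 : 0 <= C1.
Proof.
have Cp0 : 0 <= Cp.
  by apply: le_trans (law_decay law 0); rewrite mulr_ge0 ?sqr_ge0 ?(law_ge0 law).
by rewrite /C1 /step_constant !addr_ge0 // ?mulr_ge0 ?invr_ge0 ?sqr_ge0 ?(ltW delta_m).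
Qed.

Lemma truncated_cost_ge0 t : 0 <= truncated_cost t.
Proof.
by rewrite fine_ge0 // integral_ge0 // => w _; rewrite lee_fin mulr_ge0 ?step_constant_ge0.
Qed.

(** Averaging [one_step] over c, the coefficient of <v, p - r> becomes
    2 ((n+1) theta mu / S - 1).  Since theta mu = 2 mu + delta and S is
    2 L_n + (n+1) delta, this is 4 ((n+1) mu - L_n) / S. *)
Lemma deviation_step K n t (g : 'M[nat]_n.+1) : (n < t)%N ->
  (forall i, (m <= degree g i)%N) ->
  (\int[P]_w (step_average delta (fun g' => sq_deviation p K (degree g')) g (W 1%N w))%:E
   <= (sq_deviation p K (degree g)
       + (8 / kappa * `|n.+1%:R * mu - half_degree g| + truncated_cost t))%:E)%E.
Proof.
move=> nt good.
pose v := deviation p (degree g); pose S := \sum_i ((degree g i)%:R + delta).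
pose bet := \sum_(k < K) v k * (p k - prob_mass (W 1%N) k).
pose al := 2 * (n.+1%:R * theta * bet / S).
have S0 : 0 < S by exact: good_total_gt0.
have := @mean_le_affine _ _ _ P (W 1%N) W_int
  (step_average delta (fun g' => sq_deviation p K (degree g')) g)
  (fun c => C1 * (c * minn c t)%N%:R) (fun k => 2 * v k) al
  (sq_deviation p K (degree g) - 2 * \sum_(k < K) v k * p k) 0 (C1 * t%:R) K W_gt0.
rewrite -/mu -/(truncated_cost t) => h; apply: le_trans (h _ _ _) _ => {h}.
- move=> c; apply: sumr_ge0 => x _; rewrite mulr_ge0 //.
    by apply: prodr_ge0 => e _; exact: good_attach_ge0.
  by apply: sumr_ge0 => k _; exact: sqr_ge0.
- move=> c; rewrite add0r ger0_norm ?mulr_ge0 ?step_constant_ge0 // -mulrA ler_wpM2l ?step_constant_ge0 //.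
  by rewrite -natrM ler_nat mulnC leq_mul2r geq_minr orbT.
- move=> c c0; rewrite /step_average.
  have ext (x : {ffun 'I_c -> 'I_n.+1}) :
      degree (ext_graph g (fun e => x e)) = next_degree (degree g) x.
    by apply/funext => i; exact: degree_ext_graph.
  under eq_bigr do rewrite ext.
  have := one_step delta_m (fun i => good_degree good i) theta_ge0 law c0 K.
  move=> h; apply: le_trans h _; rewrite -/v -/S -/bet -/C1.
  have -> : \sum_(k < K) 2 * v k * (c == k)%:R = 2 * \sum_(k < K) v k * (c == k)%:R.
    by rewrite mulr_sumr; apply: eq_bigr => k _; rewrite mulrA.
  have hB : C1 * (c * minn c n.+1)%:R <= C1 * (c * minn c t)%:R.
    rewrite ler_wpM2l ?step_constant_ge0 // ler_nat leq_mul2l; apply/orP; right.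
    by rewrite leq_min geq_minl (leq_trans (geq_minr _ _)).
  have -> : al * c%:R = 2 * (n.+1%:R * (c%:R / S) * theta * bet) by rewrite /al; ring.
  by move: hB; lra.
have -> : \sum_(k < K) 2 * v k * prob_mass (W 1%N) k =
    2 * (\sum_(k < K) v k * p k) - 2 * bet.
  rewrite /bet !mulr_sumr -sumrB; apply: eq_bigr => k _; ring.
rewrite lee_fin.
have -> : al * mu = 2 * bet + 2 * bet * (2 * (n.+1%:R * mu - half_degree g) / S).
  have SE : S = 2 * half_degree g + n.+1%:R * delta := total_weight g.
  have -> : al * mu = 2 * bet * (n.+1%:R * (theta * mu) / S) by rewrite /al; ring.
  have e : n.+1%:R * (2 * mu + delta) = S + 2 * (n.+1%:R * mu - half_degree g).
    by rewrite SE; ring.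
  rewrite theta_mean e; move: S0 (n.+1%:R * mu - half_degree g) => S0 y.
  by field; rewrite gt_eqF.
have bet_le : `|bet| <= 2 * n.+1%:R.
  apply: le_trans (ler_norm_sum _ _ _) _; apply: le_trans (sum_abs_deviation (degree g) law K).
  apply: ler_sum => k _; rewrite normrM ler_piMr //.
  have /andP[r0 r1] := law_init law k; have p0 := law_ge0 law k.
  have p1 : p k <= 1.
    apply: le_trans (law_sum law k.+1); rewrite big_ord_recr /= lerDr sumr_ge0 // => i _.
    exact: law_ge0 law i.
  by rewrite ler_norml; apply/andP; split; lra.
have main : 2 * bet * (2 * (n.+1%:R * mu - half_degree g) / S) <=
    8 / kappa * `|n.+1%:R * mu - half_degree g|.
  apply: le_trans (ler_norm _) _.
  rewrite !normrM (ger0_norm (ler0n _ 2)) normfV (gtr0_norm S0).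
  apply: (@le_trans _ _ (2 * (2 * n.+1%:R) *
     (2 * `|n.+1%:R * mu - half_degree g| / (n.+1%:R * kappa)))).
    apply: ler_pM; rewrite ?mulr_ge0 ?invr_ge0 ?(ltW S0) //.
      by rewrite ler_wpM2l.
    rewrite ler_wpM2l ?mulr_ge0 // lef_pV2 ?posrE //; last by rewrite mulr_gt0.
    exact: good_total.
  have k0 : kappa != 0 by rewrite gt_eqF.
  have N0 : n.+1%:R != 0 :> R by rewrite pnatr_eq0.
  rewrite le_eqVlt; apply/orP; left; apply/eqP.
  move: (`|_ - _|) => a; move: (n.+1%:R : R) N0 => N N0.
  by field; rewrite ?k0 ?N0.
by move: main; lra.
Qed.

Lemma sq_deviation_ge0 K n (dg : 'I_n.+1 -> nat) : 0 <= sq_deviation p K dg.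
Proof. by apply: sumr_ge0 => k _; exact: sqr_ge0. Qed.

(** The bound does not depend on K, the number of degree classes taken into
    account. *)
Lemma deviation_bound K lam t n : 0 < lam -> (0 < n)%N -> (n <= t)%N ->
  (\int[P]_w (sq_deviation p K (degree (G n w)))%:E <=
   (16 + n%:R * (8 / kappa * (`|mu| + lam + t%:R * expected_cost lam) + truncated_cost t))%:E)%E.
Proof.
move=> l0; have k8 : 0 <= 8 / kappa by rewrite divr_ge0 // ltW.
have ec0 := expected_cost_ge0 l0; have tc0 := truncated_cost_ge0 t.
set B := 8 / kappa * _ + _.
have B0 : 0 <= B.
  by rewrite addr_ge0 // mulr_ge0 // !addr_ge0 ?mulr_ge0 // ltW.
(* At time 1 there are two vertices, whence 16 = (2 * 2)^2. *)
elim: n => // -[_ _ _|n IH _ nt].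
  apply: (@le_trans _ _ (\int[P]_(w in setT) 16%:E)%E).
    apply: ge0_le_integral => //.
    - by move=> w _; rewrite lee_fin sq_deviation_ge0.
    - have dG := @discrete_pa_graph _ _ _ P W X 1.
      exact: (measurable_discrete_fun (fun g => sq_deviation p K (degree g)) dG).
    move=> w _; rewrite lee_fin.
    apply: le_trans (sumr_sqr_le_sqr_sum K (deviation p (degree (G 1 w)))) _.
    have -> : 16 = (2 * 2%:R) ^+ 2 :> R by ring.
    rewrite ler_sqr ?nnegrE ?sumr_ge0 ?mulr_ge0 //.
    exact: (sum_abs_deviation (degree (G 1 w)) law K).
  rewrite integral_cst // [X in (_ * X)%E](probability_setT P) mule1 lee_fin.
  by rewrite mul1r lerDl.
have {}IH := IH isT (ltnW nt).
pose U (g : 'M[nat]_n.+2) : R := sq_deviation p K (degree g) +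
   (8 / kappa * (`|mu| + smooth_abs lam (half_degree g - n.+1%:R * mu)) + truncated_cost t).
apply: (@le_trans _ _ (\int[P]_w (U (G n.+1 w))%:E)%E).
  apply: (step_expectation hG (F := fun g => sq_deviation p K (degree g)) (U := U)) => //.
  - by move=> g; exact: sq_deviation_ge0.
  - move=> g; rewrite !addr_ge0 ?sq_deviation_ge0 // mulr_ge0 // addr_ge0 ?sqrtr_ge0 //.
  move=> g Pg; have good := @min_degree_of_prob_pos n.+1 g isT Pg.
  split; first exact: good_attach_ge0.
  apply: le_trans (deviation_step K nt good) _.
  rewrite lee_fin lerD2l lerD2r ler_wpM2l //.
  have := smooth_abs_ge lam (half_degree g - n.+1%:R * mu).
  have -> : n.+2%:R * mu - half_degree g = mu - (half_degree g - n.+1%:R * mu).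
    by rewrite -[n.+2%:R]natr1; ring.
  by have := ler_normB mu (half_degree g - n.+1%:R * mu); lra.
have UE w : U (G n.+1 w) = sq_deviation p K (degree (G n.+1 w)) +
  (8 / kappa * smooth_abs lam (half_degree (G n.+1 w) - n.+1%:R * mu)
   + (8 / kappa * `|mu| + truncated_cost t)) by rewrite /U; ring.
under eq_integral do rewrite UE EFinD.
have meas (F : 'M[nat]_n.+2 -> R) : measurable_fun setT (fun w => (F (G n.+1 w))%:E).
  by apply: measurable_discrete_fun; exact: discrete_pa_graph.
have sm0 w : 0 <= smooth_abs lam (half_degree (G n.+1 w) - n.+1%:R * mu) by exact: sqrtr_ge0.
rewrite ge0_integralD //; first last.
- exact: (meas (fun g => 8 / kappa * smooth_abs lam (half_degree g - n.+1%:R * mu)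
   + (8 / kappa * `|mu| + truncated_cost t))).
- by move=> w _; rewrite lee_fin !addr_ge0 // mulr_ge0.
- exact: (meas (fun g => sq_deviation p K (degree g))).
- by move=> w _; rewrite lee_fin sq_deviation_ge0.
have := @integral_add_cst n.+1 (fun g => 8 / kappa * smooth_abs lam (half_degree g - n.+1%:R * mu))
  (8 / kappa * `|mu| + truncated_cost t).
move=> -> //; last first.
- by rewrite addr_ge0 // mulr_ge0.
- by move=> w; rewrite mulr_ge0.
under [X in (_ + (X + _))%E]eq_integral do rewrite EFinM.
rewrite ge0_integralZl_EFin //; [|by move=> w _; rewrite lee_fin|]; last first.
  exact: (meas (fun g => smooth_abs lam (half_degree g - n.+1%:R * mu))).
have lln := edge_count_concentration l0 (isT : (0 < n.+1)%N).
apply: le_trans (leeD IH (leeD (lee_wpmul2l _ lln) (lexx _))) _.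
  by rewrite lee_fin.
rewrite -EFinM -!EFinD lee_fin -[n.+2%:R]natr1 mulrDl mul1r.
have nt' : n.+1%:R * expected_cost lam <= t%:R * expected_cost lam.
  by rewrite ler_wpM2r // ler_nat ltnW.
have : 8 / kappa * (lam + n.+1%:R * expected_cost lam) <=
       8 / kappa * (lam + t%:R * expected_cost lam) by rewrite ler_wpM2l // lerD2l.
move=> h.
have BE : B = 8 / kappa * `|mu| + 8 / kappa * (lam + t%:R * expected_cost lam)
    + truncated_cost t by rewrite /B; ring.
clearbody B; lra.
Qed.

End SquareDeviation.
End Recursion.

(** * From the second moment to the maximal deviation *)

Section MaxDeviation.
Context {d : measure_display} {T : measurableType d} {R : realType}.
Context (P : probability T R) (delta : R).
Context (W : nat -> {RV P >-> nat}) (X : nat -> nat -> {RV P >-> nat}).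

Let p := limit_degree delta W.
Let G n w := pa_graph W X n w.

Lemma emp_degree_deviation k n w :
  emp_degree W X R k n w - p k = deviation p (degree (G n w)) k / n.+1%:R.
Proof.
rewrite /emp_degree /nb_degree /deviation /degree_count mulrBl mulrAC divff ?mul1r; last first.
  by rewrite pnatr_eq0.
congr (_ / _ - _); rewrite -sum1_card natr_sum big_mkcond /=.
by apply: eq_bigr => i _; rewrite inE; case: eqP.
Qed.

Lemma markov_discrete n (F : 'M[nat]_n.+1 -> R) (b D : R) : 0 < b ->
  (forall g, 0 <= F g) -> (\int[P]_w (F (G n w))%:E <= D%:E)%E ->
  (P [set w | b <= F (G n w)]%R <= (D / b)%:E)%E.
Proof.
move=> b0 F0 FD; have dG := @discrete_pa_graph _ _ _ P W X n.
have mA : measurable [set w | b <= F (G n w)].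
  exact: (@discrete_preimage _ _ _ (fun w => G n w) [set g | b <= F g] dG).
suff h : (b%:E * P [set w | b <= F (G n w)]%R <= D%:E)%E.
  by rewrite mulrC EFinM lee_pdivlMl.
apply: le_trans FD.
have -> : (b%:E * P [set w | b <= F (G n w)]%R = \int[P]_(w in [set w | b <= F (G n w)]%R) b%:E)%E.
  by rewrite integral_cst.
apply: (@le_trans _ _ (\int[P]_(w in [set w | b <= F (G n w)]%R) (F (G n w))%:E)%E).
  apply: ge0_le_integral => //.
  - by move=> w _; rewrite lee_fin ltW.
  - by apply: measurable_funTS; exact: (measurable_discrete_fun F dG).
  apply: ge0_subset_integral => //; first exact: (measurable_discrete_fun F dG).
by move=> w _; rewrite lee_fin.
Qed.

(** If the supremum is at least a > 0, some deviation exceeds a/2, and so does the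
    truncated sum of squares for all large K.  These events increase with K, so
    a bound uniform in K passes to their union.  Halving a is what turns a
    supremum into an attained value. *)
Lemma prob_max_dev_le n (a D : R) : 0 < a ->
  (forall K, (\int[P]_w (sq_deviation p K (degree (G n w)))%:E <= D%:E)%E) ->
  (P [set w | (a%:E <= max_dev delta W X n w)%E] <= (4 * D / (a ^+ 2 * n.+1%:R ^+ 2))%:E)%E.
Proof.
move=> a0 hD; pose b := (a / 2 * n.+1%:R) ^+ 2.
have b0 : 0 < b by rewrite exprn_gt0 // mulr_gt0 // divr_gt0.
pose A K := [set w | b <= sq_deviation p K (degree (G n w))].
have dG := @discrete_pa_graph _ _ _ P W X n.
have mA K : measurable (A K).
  exact: (@discrete_preimage _ _ _ (fun w => G n w) [set g | b <= sq_deviation p K (degree g)] dG).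
have PA K : (P (A K) <= (4 * D / (a ^+ 2 * n.+1%:R ^+ 2))%:E)%E.
  have -> : 4 * D / (a ^+ 2 * n.+1%:R ^+ 2) = D / b.
    have := lt0r_neq0 a0; have : n.+1%:R != 0 :> R by rewrite pnatr_eq0.
    rewrite /b; move: (n.+1%:R : R) => N N0 an0; field.
    by rewrite N0 an0.
  apply: (@markov_discrete n (fun g => sq_deviation p K (degree g)) b D) => // g.
  exact: sq_deviation_ge0.
have mU : measurable (\bigcup_K A K) by exact: bigcup_measurable.
apply: (@le_trans _ _ (P (\bigcup_K A K))).
  apply: le_measure; rewrite ?inE //.
    exact: (@discrete_preimage _ _ _ (fun w => G n w)
      [set g | (a%:E <= ereal_sup [set (`|(#|[pred i : 'I_n.+1 | degree g i == k]|%:R / n.+1%:R - p k)|)%:E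
            | k in [set k | (1 <= k)%N]])%E] dG).
  move=> w /= aw; apply: contrapT => no.
  have : (max_dev delta W X n w <= (a / 2)%:E)%E.
    apply: ge_ereal_sup => _ [k k1 <-]; rewrite lee_fin -/p emp_degree_deviation.
    rewrite normf_div (ger0_norm (ler0n _ _)) ler_pdivrMr // leNgt; apply/negP => big.
    apply: no; exists k.+1 => //; rewrite /A /= /sq_deviation big_ord_recr /=.
    apply: (@le_trans _ _ (deviation p (degree (G n w)) k ^+ 2)); last first.
      by rewrite lerDr sumr_ge0 // => i _; exact: sqr_ge0.
    rewrite /b -(real_normK (num_real (deviation _ _ _))) ler_sqr ?nnegrE //; first exact: ltW.
    by rewrite mulr_ge0 // divr_ge0 // ltW.
  move=> /(le_trans aw); rewrite lee_fin; lra.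
have ndA : {homo A : i j / (i <= j)%N >-> (i <= j)%O}.
  move=> i j ij; apply/subsetPset => w; rewrite /A /= => h; apply: le_trans h _.
  rewrite /sq_deviation -!(big_mkord xpredT (fun k => deviation p (degree (G n w)) k ^+ 2)).
  rewrite [leRHS](big_cat_nat (n := i)) //= lerDl; apply: sumr_ge0 => k _; exact: sqr_ge0.
have cv := nondecreasing_cvg_mu (mu := P) mA mU ndA.
rewrite -(cvg_lim _ cv) //; apply: lime_le; first by apply/cvg_ex; eexists; exact: cv.
by apply: nearW => K; exact: PA.
Qed.

End MaxDeviation.

(** * The limit law of the model *)

Section Model.
Context {d : measure_display} {T : measurableType d} {R : realType}.
Context (P : probability T R) (delta : R).
Context (W : nat -> {RV P >-> nat}) (X : nat -> nat -> {RV P >-> nat}).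
Hypothesis hG : PARID delta W X.
Hypothesis W_int : P.-integrable setT (fun w => (W 1%N w)%:R%:E : \bar R).
Variable m : nat.
Hypothesis m_min : is_min (support_set (W 1%N)) m.
Hypothesis delta_m : 0 < delta + m%:R.

Let mu := mean (W 1%N) (fun c => c%:R).
Notation r k := (prob_mass (W 1%N) k).

Let W_gt0 w : (0 < W 1%N w)%N. Proof. exact: (parid_pos hG). Qed.

Lemma mean_degreeE : mean_degree W = mu.
Proof. by rewrite /mean_degree unlock. Qed.

Lemma mass_below_min k : (k < m)%N -> r k = 0.
Proof.
move=> km; apply/eqP; rewrite eq_le prob_mass_ge0 andbT leNgt; apply/negP => rk.
by have := m_min.2 k rk; rewrite leqNgt km.
Qed.

Lemma min_gt0 : (0 < m)%N.
Proof.
rewrite lt0n; apply/eqP => m0; have := m_min.1; rewrite /support_set /= m0 /prob_mass.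
have -> : W 1%N @^-1` [set 0%N] = set0.
  by apply/seteqP; split=> w //= W0; have := W_gt0 w; rewrite W0.
by rewrite measure0 ltxx.
Qed.

(** Bounds on the masses and on the mean are obtained by integrating pointwise
    inequalities of this shape. *)
Lemma combination_ge0 K (alpha gamma : R) (v : nat -> R) :
  (forall c, (0 < c)%N -> 0 <= alpha * c%:R + \sum_(k < K) v k * (c == k)%:R + gamma) ->
  0 <= alpha * mu + \sum_(k < K) v k * r k + gamma.
Proof.
move=> h; have := @mean_le_affine _ _ _ P (W 1%N) W_int (fun=> 0) (fun=> 0) v alpha gamma 0 0 K
  W_gt0 (fun=> lexx 0).
have -> : mean (W 1%N) (fun=> 0 : R) = 0 by rewrite /mean integral0.
rewrite integral0 !addr0 -/mu lee_fin; apply => c; first by rewrite normr0 mul0r addr0.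
by move=> c0; rewrite addr0; exact: h.
Qed.

Lemma mass_sum K : \sum_(k < K) r k <= 1.
Proof.
have := @combination_ge0 K 0 1 (fun=> -1); rewrite mul0r add0r => h.
have -> : \sum_(k < K) r k = - \sum_(k < K) -1 * r k.
  by rewrite -mulr_sumr mulN1r opprK.
rewrite lerNl -subr_ge0 opprK; apply: h => c _.
rewrite mul0r add0r -mulr_sumr mulN1r addrC subr_ge0.
exact: sum_indicator_le.
Qed.

Lemma mass_mean K : \sum_(k < K) k%:R * r k <= mu.
Proof.
have := @combination_ge0 K 1 0 (fun k => - k%:R); rewrite mul1r addr0 => h.
rewrite -subr_ge0 -sumrN; under eq_bigr do rewrite -mulNr.
apply: h => c _; rewrite mul1r addr0.
under eq_bigr do rewrite mulrC.
under eq_bigr => k _ do rewrite mulrN; rewrite sumrN (sumr_pick K (fun k => k%:R)).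
by case: ifP => _; rewrite ?subrr ?subr0.
Qed.

Lemma min_le_mean : m%:R <= mu.
Proof.
(* m <= c + m [c < m], and there is no mass below m. *)
have := @combination_ge0 m 1 (- m%:R) (fun=> m%:R); rewrite mul1r big1 => [|k _]; last first.
  by rewrite mass_below_min ?mulr0.
rewrite addr0 subr_ge0; apply => c c0; rewrite mul1r -mulr_sumr.
have := @sumr_pick R m (fun=> 1) c; under eq_bigr do rewrite mulr1; move=> ->.
case: ltnP => [_|mc]; first by rewrite mulr1 addrK.
by rewrite mulr0 addr0 subr_ge0 ler_nat.
Qed.

Lemma mean_gt0 : 0 < mu.
Proof. by apply: lt_le_trans min_le_mean; rewrite ltr0n min_gt0. Qed.

Lemma theta_mean_eq : theta delta W * mu = 2 * mu + delta.
Proof. by rewrite /theta mean_degreeE; field; rewrite gt_eqF // mean_gt0. Qed.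

Lemma theta_gt1 : 1 < theta delta W.
Proof.
rewrite /theta mean_degreeE -ltrBlDl ltr_pdivlMr ?mean_gt0 //.
by have := min_le_mean; have := delta_m; lra.
Qed.

Lemma limit_degree_law :
  limit_law delta (theta delta W) (theta delta W * (mu + `|delta|))
    (limit_degree delta W) (fun k => r k).
Proof.
apply: (@limit_seq_law _ delta (theta delta W) mu (fun k => r k) m).
- exact: min_gt0.
- exact: mass_below_min.
- by move=> k; exact: prob_mass_ge0.
- exact: mass_sum.
- exact: mass_mean.
- exact: delta_m.
- exact: theta_gt1.
Qed.

Let Cp := theta delta W * (mu + `|delta|).
Let cost t := truncated_cost delta W m (theta delta W) Cp t.

Lemma max_dev_tail lam t (a : R) : 0 < lam -> (0 < t)%N -> 0 < a ->
  (P [set w | (a%:E <= max_dev delta W X t w)%E] <=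
   (4 * (16 + t%:R * (8 / (delta + m%:R) * (mu + lam + t%:R * expected_cost W lam) + cost t))
      / (a ^+ 2 * t%:R ^+ 2))%:E)%E.
Proof.
move=> l0 t0 a0.
have th0 : 0 <= theta delta W by apply: ltW; apply: lt_trans theta_gt1.
have bound K := deviation_bound hG W_int mass_below_min delta_m th0 theta_mean_eq
  limit_degree_law K l0 t0 (leqnn t).
rewrite -/mu (ger0_norm (ltW mean_gt0)) -/Cp -/(cost t) in bound.
apply: le_trans (prob_max_dev_le a0 bound) _; rewrite lee_fin.
set D := 16 + _ in bound *.
have D0 : 0 <= D.
  rewrite -lee_fin; apply: le_trans (bound 0%N); apply: integral_ge0 => w _.
  by rewrite lee_fin sq_deviation_ge0.
have t1 : 0 < t%:R :> R by rewrite ltr0n.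
rewrite ler_wpM2l ?mulr_ge0 // lef_pV2 ?posrE ?mulr_gt0 ?exprn_gt0 //.
by rewrite ler_pM2l ?exprn_gt0 // ler_sqr ?nnegrE // ler_nat.
Qed.

End Model.

(** * Rates of convergence *)

Section Asymptotics.
Context {R : realType}.

Lemma cvg_div_ln (C : R) : (fun t : nat => C / ln t%:R) @ \oo --> (0 : R).
Proof.
apply/cvgrPdist_le => eps e0.
pose N := (Num.Def.archi_bound (expR (`|C| / eps))).+2.
exists N => // t /= Nt.
have t2 : 1 < t%:R :> R by rewrite ltr1n; apply: leq_trans Nt.
have l0 : 0 < ln t%:R :> R by exact: ln_gt0.
rewrite sub0r normrN normf_div (gtr0_norm l0) ler_pdivrMr // -ler_pdivrMl // mulrC.
rewrite -[leLHS]expRK ler_ln ?posrE ?expR_gt0 ?(lt_trans ltr01 t2) //.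
apply: ltW; apply: lt_le_trans (archi_boundP (expR_ge0 _)) _.
by rewrite ler_nat (leq_trans _ Nt) // /N; do 2 apply: leqW.
Qed.

Lemma cvg_prob_log (u : nat -> \bar R) (C : R) : (forall t, 0 <= u t)%E ->
  (forall t, (2 <= t)%N -> u t <= (C / ln t%:R)%:E)%E -> u @ \oo --> 0%E.
Proof.
move=> u0 uC; apply: (@squeeze_cvge _ _ _ _ (fun=> 0%E) _ (fun t => (C / ln t%:R)%:E)).
- by exists 2%N => // t /= t2; rewrite u0 uC.
- exact: cvg_cst.
- by apply: cvg_EFin; [apply: nearW|exact: cvg_div_ln].
Qed.

(** Thanks to this bound both parts of the theorem reduce to C / ln t -> 0. *)
Lemma powRN_le_ln (s x : R) : 0 < s -> 1 < x -> x `^ (- s) <= (s * ln x)^-1.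
Proof.
move=> s0 x1; have l0 := ln_gt0 x1; have x0 : 0 < x by exact: lt_trans x1.
rewrite powRN lef_pV2 ?posrE ?powR_gt0 ?mulr_gt0 //.
by rewrite /powR gt_eqF //; have := expR_ge1Dx (s * ln x); lra.
Qed.

(** Interpolates between a bound with a second and one with a first moment. *)
Lemma min_le_powR (a b e : R) : 0 <= a -> 0 <= b -> 0 <= e <= 1 ->
  Num.min a b <= a `^ e * b `^ (1 - e).
Proof.
move=> a0 b0 /andP[e0 e1]; set M := Num.min a b.
have M0 : 0 <= M by rewrite le_min a0.
have [->|Mn0] := eqVneq M 0; first by rewrite mulr_ge0 ?powR_ge0.
have -> : M = M `^ e * M `^ (1 - e).
  by rewrite -powRD ?Mn0 ?implybT // addrC subrK powRr1.
by apply: ler_pM; rewrite ?powR_ge0 // ge0_ler_powR ?nnegrE ?subr_ge0 // ge_min lexx ?orbT.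
Qed.

Lemma truncated_square_le (c t : nat) (e : R) : 0 < e <= 1 -> (0 < c)%N -> (0 < t)%N ->
  (c * minn c t)%:R <= t%:R `^ (1 - e) * c%:R `^ (1 + e).
Proof.
move=> /andP[e0 e1] c0 t0.
have cp : 0 < c%:R :> R by rewrite ltr0n.
have -> : (c * minn c t)%:R = Num.min (c%:R ^+ 2) (c%:R * t%:R) :> R.
  by rewrite natrM natr_min minr_pMr // expr2.
apply: le_trans (@min_le_powR _ _ e _ _ _) _; rewrite ?sqr_ge0 ?mulr_ge0 ?(ltW e0) //.
rewrite -powR_mulrn // -powRrM powRM // mulrA -powRD; last by rewrite (lt0r_neq0 cp) implybT.
by rewrite mulrC (_ : 2%:R * e + (1 - e) = 1 + e) //; lra.
Qed.

Lemma increment_cost_le (lam mu e : R) (c : nat) : 0 < e <= 1 -> 0 < lam -> 0 <= mu -> (0 < c)%N ->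
  increment_cost lam (c%:R - mu) <=
  lam `^ (- e) * (2 `^ (1 - e) * (1 + mu) `^ (1 + e)) * c%:R `^ (1 + e).
Proof.
move=> /andP[e0 e1] l0 mu0 c0.
have c1 : 1 <= c%:R :> R by rewrite ler1n.
have mu1 : 0 <= 1 + mu by lra.
set y := (1 + mu) * c%:R; have y0 : 0 < y by rewrite mulr_gt0; lra.
have uy : `|c%:R - mu| <= y.
  have : 0 <= mu * c%:R by rewrite mulr_ge0.
  have : mu <= mu * c%:R by rewrite ler_peMr.
  by rewrite /y ler_norml => *; apply/andP; split; lra.
apply: (@le_trans _ _ (Num.min (y ^+ 2 / lam) (2 * y))).
  rewrite le_min !ge_min; apply/andP; split; apply/orP; [left|right].
    rewrite ler_pM2r ?invr_gt0 // -[leLHS]real_normK ?num_real //.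
    by rewrite ler_sqr ?nnegrE // ltW.
  by rewrite ler_pM2l.
apply: le_trans (@min_le_powR _ _ e _ _ _) _; rewrite ?divr_ge0 ?sqr_ge0 ?mulr_ge0 ?(ltW e0) ?(ltW y0) ?(ltW l0) //.
rewrite -powR_mulrn ?(ltW y0) // [X in X * _]powRM ?powR_ge0 ?invr_ge0 ?(ltW l0) //.
rewrite [(2 * y) `^ _]powRM ?(ltW y0) // -powRrM -(powR_inv1 (ltW l0)) -powRrM mulN1r.
have yE : y `^ (1 + e) = y `^ (2%:R * e) * y `^ (1 - e).
  by rewrite -powRD ?(lt0r_neq0 y0) ?implybT //; congr (_ `^ _); lra.
have -> : y `^ (2%:R * e) * lam `^ (- e) * (2 `^ (1 - e) * y `^ (1 - e)) =
   lam `^ (- e) * 2 `^ (1 - e) * y `^ (1 + e) by rewrite yE; ring.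
by rewrite /y powRM ?mulrA.
Qed.

End Asymptotics.

Section Moments.
Context {d : measure_display} {T : measurableType d} {R : realType}.
Context (P : probability T R) (Y : {RV P >-> nat}).
Hypothesis Y_gt0 : forall w, (0 < Y w)%N.

Lemma integrable_lower_moment (e e' : R) : e <= e' ->
  (\int[P]_w ((Y w)%:R `^ e')%:E < +oo)%E ->
  P.-integrable setT (fun w => ((Y w)%:R `^ e)%:E).
Proof.
move=> ee fin; have mY f := measurable_discrete_fun (R := R) f (discrete_RV Y).
apply: (@le_integrable _ _ _ P _ measurableT _ (fun w => ((Y w)%:R `^ e')%:E)).
- exact: (mY (fun c => c%:R `^ e)).
- move=> w _; rewrite lee_fin !ger0_norm ?powR_ge0 // ler_powR // ler1n //.
apply/integrableP; split; first exact: (mY (fun c => c%:R `^ e')).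
by under eq_integral do rewrite gee0_abs ?lee_fin ?powR_ge0 //.
Qed.

Lemma integrable_RV (e : R) : 1 <= e -> (\int[P]_w ((Y w)%:R `^ e)%:E < +oo)%E ->
  P.-integrable setT (fun w => (Y w)%:R%:E : \bar R).
Proof.
move=> e1 fin; have := integrable_lower_moment e1 fin.
by apply: eq_integrable => // w _; rewrite powRr1.
Qed.

Lemma mean_le_moment (f : nat -> R) (k e a b : R) :
  P.-integrable setT (fun w => (Y w)%:R%:E : \bar R) ->
  P.-integrable setT (fun w => ((Y w)%:R `^ e)%:E) ->
  (forall c, `|f c| <= a + b * c%:R) ->
  (forall c, (0 < c)%N -> f c <= k * c%:R `^ e) ->
  mean Y f <= k * mean Y (fun c => c%:R `^ e).
Proof.
move=> Yi Ye fb fk.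
rewrite -lee_fin EFinM -(meanE Yi fb) /mean fineK ?integrable_fin_num //.
rewrite -integralZl //; apply: le_integral => //.
- exact: integrable_affine_bound fb.
- exact: integrableZl.
by move=> w _; rewrite -EFinM lee_fin fk.
Qed.

Lemma mean_le_deterministic (f : nat -> R) (k : nat) (a b : R) :
  P.-integrable setT (fun w => (Y w)%:R%:E : \bar R) ->
  (forall c, `|f c| <= a + b * c%:R) ->
  prob_mass Y k = 1 -> mean Y f <= f k.
Proof.
move=> Yi fb rk; rewrite -lee_fin -(meanE Yi fb).
have -> : (\int[P]_w (f (Y w))%:E = \int[P]_w (f k)%:E)%E.
  apply: ae_eq_integral => //.
  - exact: (measurable_discrete_fun f (discrete_RV Y)).
  have PC : P (~` (Y @^-1` [set k])) = 0%E.
    have mk := @discrete_RV _ _ _ _ Y k.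
    rewrite probability_setC // -(fineK (fin_num_measure P _ mk)).
    by move: rk; rewrite /prob_mass => ->; rewrite subee.
  exists (~` (Y @^-1` [set k])); split.
  - by apply: measurableC; exact: discrete_RV.
  - exact: PC.
  - by move=> w /= h Yk; apply: h => _; rewrite Yk.
by rewrite integral_cst // [X in (_ * X)%E](probability_setT P) mule1.
Qed.

End Moments.

Section Rates.
Context {d : measure_display} {T : measurableType d} {R : realType}.
Context (P : probability T R) (delta : R).
Context (W : nat -> {RV P >-> nat}) (X : nat -> nat -> {RV P >-> nat}).
Hypothesis hG : PARID delta W X.
Hypothesis W_int : P.-integrable setT (fun w => (W 1%N w)%:R%:E : \bar R).
Variable m : nat.
Hypothesis m_min : is_min (support_set (W 1%N)) m.
Hypothesis delta_m : 0 < delta + m%:R.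

Let mu := mean (W 1%N) (fun c => c%:R).
Let kappa := delta + m%:R.
Let Cp := theta delta W * (mu + `|delta|).
Let C1 := step_constant (theta delta W) Cp kappa.
Let cost t := truncated_cost delta W m (theta delta W) Cp t.

Let W_gt0 w : (0 < W 1%N w)%N. Proof. exact: (parid_pos hG). Qed.

Let mu_gt0 : 0 < mu. Proof. exact: (mean_gt0 hG W_int m_min). Qed.

Let step_constant_ge0 : 0 <= C1.
Proof.
have law := limit_degree_law hG W_int m_min delta_m.
have th0 : 0 <= theta delta W.
  by apply: ltW; apply: lt_trans (theta_gt1 hG W_int m_min delta_m).
exact: (step_constant_ge0 delta_m th0 law).
Qed.

Lemma cost_integrand_bound t c : `|C1 * (c * minn c t)%N%:R| <= 0 + (C1 * t%:R) * c%:R.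
Proof.
rewrite add0r ger0_norm ?mulr_ge0 // -mulrA ler_wpM2l //.
by rewrite -natrM ler_nat mulnC leq_mul2r geq_minr orbT.
Qed.

Lemma increment_cost_affine lam c : 0 < lam ->
  `|increment_cost lam (c%:R - mu)| <= 2 * mu + 2 * c%:R.
Proof.
move=> l0; have /andP[b0 b1] := increment_cost_bound l0 (c%:R - mu).
rewrite ger0_norm // (le_trans b1) // -mulrDr ler_pM2l // [leRHS]addrC.
by rewrite (le_trans (ler_normB _ _)) // normr_nat (gtr0_norm mu_gt0).
Qed.

(** With lam = t^(1/2), and y = t^(1 - e/2), all terms of [max_dev_tail] are at
    most constant multiples of t y; dividing by t^2 a^2 with a = t^(-e/8) leaves
    t^(-e/4). *)
Lemma max_dev_rate_moment (e : R) : 0 < e <= 1 ->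
  (\int[P]_w ((W 1%N w)%:R `^ (1 + e))%:E < +oo)%E ->
  exists C : R, forall t, (2 <= t)%N ->
    (P [set w | ((t%:R `^ (- (e / 8)))%:E <= max_dev delta W X t w)%E] <= (C / ln t%:R)%:E)%E.
Proof.
move=> e01 fin; have /andP[e0 e1] := e01.
have Ye := integrable_lower_moment W_gt0 (lexx _) fin.
pose M := mean (W 1%N) (fun c => c%:R `^ (1 + e)).
have M0 : 0 <= M.
  by rewrite fine_ge0 // integral_ge0 // => w _; rewrite lee_fin powR_ge0.
pose k := 2 `^ (1 - e) * (1 + mu) `^ (1 + e).
have k0 : 0 <= k by rewrite mulr_ge0 ?powR_ge0.
pose D := 16 + (8 / kappa * (mu + 1 + k * M) + C1 * M).
have k8 : 0 <= 8 / kappa by rewrite divr_ge0 // ltW.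
have D0 : 0 <= D.
  have h1 : 0 <= mu + 1 + k * M.
    exact: (addr_ge0 (addr_ge0 (ltW mu_gt0) ler01) (mulr_ge0 k0 M0)).
  exact: (addr_ge0 (ler0n _ 16) (addr_ge0 (mulr_ge0 k8 h1) (mulr_ge0 step_constant_ge0 M0))).
exists (16 * D / e) => t t2.
have t0 : (0 < t)%N by apply: leq_trans t2.
pose x : R := t%:R; have x1 : 1 < x by rewrite ltr1n.
have x0 : 0 < x by apply: lt_trans x1.
have a0 : 0 < x `^ (- (e / 8)) by rewrite powR_gt0.
have l0 : 0 < x `^ (2^-1) by rewrite powR_gt0.
apply: le_trans (max_dev_tail hG W_int m_min delta_m l0 t0 a0) _.
rewrite lee_fin -/mu -/Cp -/(cost t) -/kappa -/x.
have cost_le : cost t <= C1 * M * x `^ (1 - e).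
  rewrite /cost /truncated_cost -/kappa -/C1.
  have := @mean_le_moment _ _ _ P (W 1%N) W_gt0 (fun c => C1 * (c * minn c t)%N%:R)
    (C1 * x `^ (1 - e)) (1 + e) 0 (C1 * t%:R) W_int Ye (cost_integrand_bound t).
  rewrite -/M [_ * M]mulrAC; apply => c c0.
  by rewrite -mulrA ler_wpM2l // truncated_square_le.
have ec_le : expected_cost W (x `^ (2^-1)) <= x `^ (- (e / 2)) * k * M.
  have := @mean_le_moment _ _ _ P (W 1%N) W_gt0 (fun c => increment_cost (x `^ 2^-1) (c%:R - mu))
    (x `^ (- (e / 2)) * k) (1 + e) (2 * mu) 2 W_int Ye (fun c => increment_cost_affine c l0).
  apply => c c0.
  have := increment_cost_le e01 l0 (ltW mu_gt0) c0.
  by rewrite -powRrM -/k (_ : 2^-1 * - e = - (e / 2)) //; lra.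
pose y := x `^ (1 - e / 2).
have y1 : 1 <= y by rewrite -(powRr0 x) ler_powR ?(ltW x1) //; lra.
have y2 : x `^ 2^-1 <= y by rewrite ler_powR ?(ltW x1) //; lra.
have y3 : x * x `^ (- (e / 2)) = y.
  by rewrite -{1}(powRr1 (ltW x0)) -powRD ?(lt0r_neq0 x0) ?implybT.
have y4 : x `^ (1 - e) <= y by rewrite ler_powR ?(ltW x1) //; lra.
have num : 16 + x * (8 / kappa * (mu + x `^ 2^-1 + x * expected_cost W (x `^ 2^-1)) + cost t)
    <= x * y * D.
  have h1 : x * expected_cost W (x `^ 2^-1) <= k * M * y.
    apply: le_trans (ler_wpM2l (ltW x0) ec_le) _.
    by rewrite -y3 le_eqVlt; apply/orP; left; apply/eqP; ring.
  have h2 : cost t <= C1 * M * y.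
    exact: (le_trans cost_le (ler_wpM2l (mulr_ge0 step_constant_ge0 M0) y4)).
  have h3 : mu <= mu * y by rewrite ler_peMr // ltW.
  have h4 : 8 / kappa * (mu + x `^ 2^-1 + x * expected_cost W (x `^ 2^-1))
     <= 8 / kappa * (mu * y + y + k * M * y).
    by rewrite ler_wpM2l // !lerD.
  have h5 : 16 <= x * y * 16 by rewrite ler_peMl // mulr_ege1 // ltW.
  have h6 := ler_wpM2l (ltW x0) (lerD h4 h2).
  apply: le_trans (lerD h5 h6) _; rewrite le_eqVlt; apply/orP; left; apply/eqP.
  by rewrite /D; ring.
apply: (@le_trans _ _ (4 * (x * y * D) / ((x `^ (- (e / 8))) ^+ 2 * x ^+ 2))).
  apply: ler_wpM2r; last by rewrite ler_wpM2l.
  by rewrite invr_ge0 (mulr_ge0 (sqr_ge0 _) (sqr_ge0 _)).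
have -> : 4 * (x * y * D) / ((x `^ (- (e / 8))) ^+ 2 * x ^+ 2) = 4 * D * x `^ (- (e / 4)).
  have x8 : x `^ (- (e / 8)) != 0 by rewrite gt_eqF.
  apply: (mulIf (x := x `^ (- (e / 8)) ^+ 2 * x ^+ 2)).
    by rewrite mulf_neq0 ?sqrf_eq0 ?expf_neq0 ?(lt0r_neq0 x0).
  rewrite divfK; last by rewrite mulf_neq0 ?expf_neq0 ?(lt0r_neq0 x0).
  have -> : x `^ (- (e / 8)) ^+ 2 = x `^ (- (e / 4)).
    by rewrite -powR_mulrn ?powR_ge0 // -powRrM; congr (_ `^ _); lra.
  have -> : y = x * (x `^ (- (e / 4)) * x `^ (- (e / 4))).
    rewrite -y3 -powRD ?(lt0r_neq0 x0) ?implybT //; congr (_ * _ `^ _); lra.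
  by ring.
have ln0 : 0 < ln x by exact: ln_gt0.
have e4 : 0 < e / 4 by rewrite divr_gt0.
apply: le_trans (ler_wpM2l _ (powRN_le_ln e4 x1)) _; first by rewrite mulr_ge0.
rewrite le_eqVlt; apply/orP; left; apply/eqP; field.
by rewrite ?(lt0r_neq0 ln0) ?(lt0r_neq0 e0).
Qed.

(** Here [expected_cost] vanishes and [truncated_cost] is bounded, so the second
    moment is O(t). *)
Lemma max_dev_rate_deterministic k : prob_mass (W 1%N) k = 1 ->
  exists C : R, forall t, (2 <= t)%N ->
    (P [set w | ((1 * Num.sqrt (ln t%:R / t%:R))%:E <= max_dev delta W X t w)%E]
       <= (C / ln t%:R)%:E)%E.
Proof.
move=> rk.
have mu_k : mu = k%:R.
  apply/eqP; rewrite eq_le; apply/andP; split.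
    apply: (mean_le_deterministic (f := fun c => c%:R) (a := 0) (b := 1)) => // c.
    by rewrite add0r mul1r normr_nat.
  have := mass_mean hG W_int k.+1; apply: le_trans.
  rewrite big_ord_recr /= rk mulr1 lerDr sumr_ge0 // => i _.
  by rewrite mulr_ge0 ?prob_mass_ge0.
have ec_le : expected_cost W 1 <= 0.
  apply: le_trans (mean_le_deterministic (f := fun c => increment_cost 1 (c%:R - mu))
     W_int (fun c => increment_cost_affine c ltr01) rk) _.
  by rewrite mu_k subrr /increment_cost ge_min expr0n mul0r lexx.
pose D := 16 + (8 / kappa * (mu + 1) + C1 * (k * k)%:R).
have k8 : 0 <= 8 / kappa by rewrite divr_ge0 // ltW.
exists (4 * D) => t t2.
have t0 : (0 < t)%N by apply: leq_trans t2.
pose x : R := t%:R; have x1 : 1 < x by rewrite ltr1n.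
have x0 : 0 < x by apply: lt_trans x1.
have ln0 : 0 < ln x by exact: ln_gt0.
have a0 : 0 < 1 * Num.sqrt (ln x / x) by rewrite mul1r sqrtr_gt0 divr_gt0.
apply: le_trans (max_dev_tail hG W_int m_min delta_m ltr01 t0 a0) _.
rewrite lee_fin -/mu -/Cp -/(cost t) -/kappa -/x.
have cost_le : cost t <= C1 * (k * k)%:R.
  apply: le_trans (mean_le_deterministic (f := fun c => C1 * (c * minn c t)%N%:R)
     W_int (cost_integrand_bound t) rk) _.
  by rewrite ler_wpM2l // ler_nat leq_mul2l geq_minl orbT.
have num : 16 + x * (8 / kappa * (mu + 1 + x * expected_cost W 1) + cost t) <= x * D.
  have h1 : x * expected_cost W 1 <= 0 by rewrite pmulr_rle0.
  have h4 : 8 / kappa * (mu + 1 + x * expected_cost W 1) <= 8 / kappa * (mu + 1).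
    by rewrite ler_wpM2l // gerDl.
  have h5 : 16 <= x * 16 by rewrite ler_peMl // ltW.
  have h6 := ler_wpM2l (ltW x0) (lerD h4 cost_le).
  by apply: le_trans (lerD h5 h6) _; rewrite -mulrDr.
apply: (@le_trans _ _ (4 * (x * D) / ((1 * Num.sqrt (ln x / x)) ^+ 2 * x ^+ 2))).
  apply: ler_wpM2r; last by rewrite ler_wpM2l.
  by rewrite invr_ge0 (mulr_ge0 (sqr_ge0 _) (sqr_ge0 _)).
rewrite mul1r sqr_sqrtr ?divr_ge0 ?(ltW ln0) ?(ltW x0) //.
rewrite le_eqVlt; apply/orP; left; apply/eqP; field.
by rewrite ?(lt0r_neq0 ln0) ?(lt0r_neq0 x0).
Qed.

End Rates.

Theorem theorem1p3 (d : measure_display) (T : measurableType d) (R : realType)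
    (P : probability T R) (delta : R)
    (W : nat -> {RV P >-> nat}) (X : nat -> nat -> {RV P >-> nat})
    (hG : PARID delta W X)
    (hmoment : exists2 eps : R, 0 < eps &
       ('E_P[(fun w => (W 1%N w)%:R `^ (1 + eps))%R] < +oo)%E) :
  (exists gamma : R, 0 < gamma < 1 / 2 /\
     (fun t : nat => P [set w | ((t%:R `^ (- gamma))%:E
                                  <= max_dev delta W X t w)%E]) @ \oo --> 0%E)
  /\
  ((exists2 m : nat, (1 <= m)%N & prob_mass (W 1%N) m = 1) ->
   exists C : R,
     (fun t : nat => P [set w | ((C * Num.sqrt (ln t%:R / t%:R))%:E
                                  <= max_dev delta W X t w)%E]) @ \oo --> 0%E).
Proof.
have [m [m_min delta_m]] := parid_delta hG.
have W_gt0 w : (0 < W 1%N w)%N by exact: (parid_pos hG).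
have [eps eps0] := hmoment; rewrite unlock => fin.
have eps1 : 1 <= 1 + eps by rewrite lerDl ltW.
have W_int := integrable_RV W_gt0 eps1 fin.
split.
  pose e := Num.min 1 eps.
  have e01 : 0 < e <= 1 by rewrite /e lt_min ltr01 eps0 ge_min lexx.
  have ee : 1 + e <= 1 + eps by rewrite lerD2l /e ge_min lexx orbT.
  have fine_e : (\int[P]_w ((W 1%N w)%:R `^ (1 + e))%:E < +oo)%E.
    exact: integrable_lty (integrable_lower_moment W_gt0 ee fin).
  exists (e / 8); split; first by move: e01; lra.
  have [C hC] := max_dev_rate_moment hG W_int m_min delta_m e01 fine_e.
  exact: cvg_prob_log hC.
move=> [k _ rk]; exists 1.
have [C hC] := max_dev_rate_deterministic hG W_int m_min delta_m rk.
exact: cvg_prob_log hC.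
Qed.
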